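(* Let $\mathbb{K}$ be a field of characteristic zero, let $k,p\ge 1$ and let $n_1,\dots,n_k,m_1,\dots,m_p\ge 1$ be integers. Let $SN=SN(n_1,\dots,n_k,1\,|\,m_1,\dots,m_p)$ be the Lie superalgebra over $\mathbb{K}$ defined in the context (the maximal-dimensional solvable Lie superalgebra with model nilpotent nilradical). Then $SN$ is a complete Lie superalgebra, i.e. $$\mathrm{H}^i(SN;SN)=\{0\},\qquad i=0,1,2.$$
   Context: The Lie superalgebra $SN(n_1,\dots,n_k,1\,|\,m_1,\dots,m_p)$. Its even part has basis $x_1,\dots,x_{n_1+\cdots+n_k+1},t_1,\dots,t_{k+1},t'_1,\dots,t'_p$ and its odd part has basis $y_1,\dots,y_{m_1+\cdots+m_p}$. The only non-zero brackets of basis elements (up to the super skew-symmetry $[X,Y]=-(-1)^{|X||Y|}[Y,X]$) are - $[x_1,x_j]=x_{j+1}$ for $2\le j\le n_1$; - $[x_1,x_{n_1+\cdots+n_j+i}]=x_{n_1+\cdots+n_j+i+1}$ for $1\le j\le k-1$, $2\le i\le n_{j+1}$; - $[x_1,y_j]=y_{j+1}$ for $1\le j\le m_1-1$; - $[x_1,y_{m_1+\cdots+m_j+i}]=y_{m_1+\cdots+m_j+i+1}$ for $1\le j\le p-1$, $1\le i\le m_{j+1}-1$; - $[t_1,x_i]=i\,x_i$ for $1\le i\le n_1+\cdots+n_k+1$; - $[t_1,y_j]=j\,y_j$ for $1\le j\le m_1+\cdots+m_p$; - $[t_2,x_i]=x_i$ for $2\le i\le n_1+1$; - $[t_{j+2},x_{n_1+\cdots+n_j+i}]=x_{n_1+\cdots+n_j+i}$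 for $1\le j\le k-1$, $2\le i\le n_{j+1}+1$; - $[t'_1,y_i]=y_i$ for $1\le i\le m_1$; - $[t'_{j+1},y_{m_1+\cdots+m_j+i}]=y_{m_1+\cdots+m_j+i}$ for $1\le j\le p-1$, $1\le i\le m_{j+1}$. In particular the bracket of any two odd elements is zero. Cohomology. For a Lie superalgebra $\mathfrak g=\mathfrak g_{\bar 0}\oplus\mathfrak g_{\bar 1}$ and a $\mathfrak g$-module $A=A_{\bar 0}\oplus A_{\bar 1}$, the $q$-cochains are $C^q(\mathfrak g;A)=\bigoplus_{q_0+q_1=q}\mathrm{Hom}(\wedge^{q_0}\mathfrak g_{\bar 0}\otimes S^{q_1}\mathfrak g_{\bar 1},A)$ (linear maps of both parities). The differential is $$\begin{aligned}(dc)(g_1,\dots,g_{q_0},h_1,\dots,h_{q_1})={}&\sum_{1\le s<t\le q_0}(-1)^{s+t-1}c([g_s,g_t],g_1,\dots,\hat g_s,\dots,\hat g_t,\dots,g_{q_0},h_1,\dots,h_{q_1})\\&+\sum_{s=1}^{q_0}\sum_{t=1}^{q_1}(-1)^{s-1}c(g_1,\dots,\hat g_s,\dots,g_{q_0},[g_s,h_t],h_1,\dots,\hat h_t,\dots,h_{q_1})\\&+\sum_{1\le s<t\le q_1}c([h_s,h_t],g_1,\dots,g_{q_0},h_1,\dots,\hat h_s,\dots,\hat h_t,\dots,h_{q_1})\\&+\sum_{s=1}^{q_0}(-1)^s g_s\cdot c(g_1,\dots,\hat g_s,\dots,g_{q_0},h_1,\dots,h_{q_1})\\&+(-1)^{q_0-1}\sum_{s=1}^{q_1}h_s\cdot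 c(g_1,\dots,g_{q_0},h_1,\dots,\hat h_s,\dots,h_{q_1})\end{aligned}$$ for $g_i\in\mathfrak g_{\bar 0}$, $h_j\in\mathfrak g_{\bar 1}$. It satisfies $d\circ d=0$, and $\mathrm{H}^q(\mathfrak g;A)=Z^q(\mathfrak g;A)/B^q(\mathfrak g;A)$ (cocycles modulo coboundaries). $\mathrm{H}^q(\mathfrak g;\mathfrak g)$ denotes cohomology with coefficients in the adjoint module. A Lie superalgebra $\mathfrak g$ is called complete here if $\mathrm{H}^i(\mathfrak g;\mathfrak g)=0$ for $i=0,1,2$. *)

(* Defs.v *)
From mathcomp Require Import all_boot all_algebra zify.

Set Implicit Arguments.
Unset Strict Implicit.
Unset Printing Implicit Defensive.

Import GRing.Theory.
Local Open Scope ring_scope.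

(* A Lie superalgebra g = g0 (+) g1 is given by its homogeneous parts and the
   components g0 x g0 -> g0, g0 x g1 -> g1 and g1 x g1 -> g0 of the bracket; the
   component g1 x g0 -> g1 is [h, g] := - [g, h], as super skew-symmetry
   requires.  The four Jacobi fields are the homogeneous cases of
     [x, [y, z]] = [[x, y], z] + (-1)^(|x||y|) [y, [x, z]].
   Over a field of characteristic 2 or 3 one would ask for more. *)
Record lieSuperalgebra (K : fieldType) := LieSuperalgebra {
  even_part : lmodType K;
  odd_part : lmodType K;
  br00 : even_part -> even_part -> even_part;
  br01 : even_part -> odd_part -> odd_part;
  br11 : odd_part -> odd_part -> even_part;
  br00_linearl : forall v, linear (br00^~ v);
  br00_linearr : forall u, linear (br00 u);
  br01_linearl : forall v, linear (br01^~ v);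
  br01_linearr : forall u, linear (br01 u);
  br11_linearl : forall v, linear (br11^~ v);
  br11_linearr : forall u, linear (br11 u);
  br00_skew : forall u v, br00 u v = - br00 v u;
  br11_sym : forall u v, br11 u v = br11 v u;
  jacobi000 : forall a b c,
    br00 a (br00 b c) = br00 (br00 a b) c + br00 b (br00 a c);
  jacobi001 : forall a b h,
    br01 a (br01 b h) = br01 (br00 a b) h + br01 b (br01 a h);
  jacobi011 : forall a h h',
    br00 a (br11 h h') = br11 (br01 a h) h' + br11 h (br01 a h');
  jacobi111 : forall h1 h2 h3,
    - br01 (br11 h2 h3) h1 = br01 (br11 h1 h2) h3 + br01 (br11 h1 h3) h2
}.

Fact pair_ext (U V : Type) (u v : U * V) : u.1 = v.1 -> u.2 = v.2 -> u = v.
Proof. by case: u v => [? ?] [? ?] /= -> ->. Qed.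

Section LinearFacts.

Variables (K : fieldType) (U V : lmodType K) (f : U -> V).
Hypothesis f_lin : linear f.

Fact linD u v : f (u + v) = f u + f v.
Proof. by rewrite -{1}[u]scale1r f_lin scale1r. Qed.

Fact lin0 : f 0 = 0.
Proof. by apply: (addrI (f 0)); rewrite -linD !addr0. Qed.

Fact linZ k u : f (k *: u) = k *: f u.
Proof. by rewrite -[k *: u]addr0 f_lin lin0 addr0. Qed.

Fact linN u : f (- u) = - f u.
Proof. by rewrite -scaleN1r linZ scaleN1r. Qed.

Fact lin_sum (I : finType) (F : I -> U) : f (\sum_i F i) = \sum_i f (F i).
Proof. exact: (big_morph f linD lin0). Qed.

End LinearFacts.

Section Modules.

Variables (K : fieldType) (g : lieSuperalgebra K).
Local Notation g0 := (even_part g).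
Local Notation g1 := (odd_part g).

(* A module is A = A0 (+) A1, realised as the product A0 * A1. *)
Definition even_action (A0 A1 : lmodType K) (a00 : g0 -> A0 -> A0)
    (a01 : g0 -> A1 -> A1) (x : g0) (v : A0 * A1) : A0 * A1 :=
  (a00 x v.1, a01 x v.2).

Definition odd_action (A0 A1 : lmodType K) (a10 : g1 -> A0 -> A1)
    (a11 : g1 -> A1 -> A0) (h : g1) (v : A0 * A1) : A0 * A1 :=
  (a11 h v.2, a10 h v.1).

Record supermodule := Supermodule {
  even_carrier : lmodType K;
  odd_carrier : lmodType K;
  act00 : g0 -> even_carrier -> even_carrier;
  act01 : g0 -> odd_carrier -> odd_carrier;
  act10 : g1 -> even_carrier -> odd_carrier;
  act11 : g1 -> odd_carrier -> even_carrier;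
  act0 := even_action act00 act01;
  act1 := odd_action act10 act11;
  act0_linearl : forall v, linear (act0^~ v);
  act0_linearr : forall x, linear (act0 x);
  act1_linearl : forall v, linear (act1^~ v);
  act1_linearr : forall h, linear (act1 h);
  act_br00 : forall x y v,
    act0 (br00 x y) v = act0 x (act0 y v) - act0 y (act0 x v);
  act_br01 : forall x h v,
    act1 (br01 x h) v = act0 x (act1 h v) - act1 h (act0 x v);
  act_br11 : forall h h' v,
    act0 (br11 h h') v = act1 h (act1 h' v) + act1 h' (act1 h v)
}.

Definition carrier (A : supermodule) : lmodType K :=
  (even_carrier A * odd_carrier A)%type.

Local Notation ad0 := (even_action (@br00 K g) (@br01 K g)).
Local Notation ad1 :=
  (odd_action (fun (h : g1) (x : g0) => - br01 x h) (@br11 K g)).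

Fact ad0_linearl v : linear (ad0^~ v).
Proof.
by move=> k x y; congr pair; rewrite /= ?br00_linearl ?br01_linearl.
Qed.

Fact ad0_linearr x : linear (ad0 x).
Proof.
by move=> k u v; congr pair; rewrite /= ?br00_linearr ?br01_linearr.
Qed.

Fact ad1_linearl v : linear (ad1^~ v).
Proof.
move=> k x y; congr pair; rewrite /= ?br11_linearl ?br01_linearr //.
by rewrite opprD scalerN.
Qed.

Fact ad1_linearr x : linear (ad1 x).
Proof.
move=> k u v; congr pair; rewrite /= ?br11_linearr ?br01_linearl //.
by rewrite opprD scalerN.
Qed.

Fact ad_br00 x y v : ad0 (br00 x y) v = ad0 x (ad0 y v) - ad0 y (ad0 x v).
Proof.
apply: pair_ext => /=.
- by rewrite (jacobi000 x y) addrK.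
- by rewrite (jacobi001 x y) addrK.
Qed.

Fact ad_br01 x h v : ad1 (br01 x h) v = ad0 x (ad1 h v) - ad1 h (ad0 x v).
Proof.
apply: pair_ext => /=; first by rewrite jacobi011 addrK.
by rewrite (linN (br01_linearr x)) (jacobi001 x v.1 h) opprD opprK addrAC addNr add0r.
Qed.

Fact ad_br11 h h' v : ad0 (br11 h h') v = ad1 h (ad1 h' v) + ad1 h' (ad1 h v).
Proof.
apply: pair_ext => /=.
  rewrite (linN (br11_linearr h)) (linN (br11_linearr h')).
  rewrite (br00_skew _ v.1) jacobi011 opprD addrC.
  by rewrite (br11_sym (br01 v.1 h)).
have := jacobi111 v.2 h h'; rewrite (br11_sym v.2 h) (br11_sym v.2 h').
by move/(congr1 -%R); rewrite opprK opprD addrC.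
Qed.

Definition adjoint : supermodule :=
  Supermodule ad0_linearl ad0_linearr ad1_linearl ad1_linearr
    ad_br00 ad_br01 ad_br11.

End Modules.

Section Cohomology.

Variables (K : fieldType) (g : lieSuperalgebra K) (A : supermodule g).
Local Notation g0 := (even_part g).
Local Notation g1 := (odd_part g).

(* A linear map from the direct sum over q0 + q1 = q of the spaces
   /\^q0 g0 (x) S^q1 g1 to A, seen as a function of a sequence of q0 elements of
   g0 and a sequence of q1 elements of g1 that is multilinear, alternating in
   the former and symmetric in the latter.  It is extended by 0 to the pairs of
   sequences with q0 + q1 <> q. *)
Record cochain (q : nat) (c : seq g0 -> seq g1 -> carrier A) : Prop := Cochain {
  cochain_support : forall gs hs, (size gs + size hs)%N != q -> c gs hs = 0;
  cochain_linear0 : forall gs gs' hs, linear (fun x => c (gs ++ x :: gs') hs);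
  cochain_linear1 : forall gs hs hs', linear (fun h => c gs (hs ++ h :: hs'));
  cochain_alternating : forall gs gs' gs'' x hs,
    c (gs ++ x :: gs' ++ x :: gs'') hs = 0;
  cochain_symmetric : forall gs hs hs', perm_eq hs hs' -> c gs hs = c gs hs'
}.

Definition del (T : Type) (i : nat) (s : seq T) : seq T :=
  take i s ++ drop i.+1 s.

(* Indices start at 0 here, which shifts the exponents of the signs: s + t - 1,
   s - 1, s and q0 - 1 become s + t + 1, s, s + 1 and (modulo 2) q0 + 1. *)
Definition differential (c : seq g0 -> seq g1 -> carrier A)
    (gs : seq g0) (hs : seq g1) : carrier A :=
  let q0 := size gs in
  let q1 := size hs in
  \sum_(s < q0) \sum_(t < q0 | (s < t)%N)
      (-1) ^+ (s + t + 1) *: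
        c (br00 gs`_s gs`_t :: del s (del t gs)) hs
  + \sum_(s < q0) \sum_(t < q1)
      (-1) ^+ s *: c (del s gs) (br01 gs`_s hs`_t :: del t hs)
  + \sum_(s < q1) \sum_(t < q1 | (s < t)%N)
      c (br11 hs`_s hs`_t :: gs) (del s (del t hs))
  + \sum_(s < q0) (-1) ^+ s.+1 *: act0 gs`_s (c (del s gs) hs)
  + (-1) ^+ q0.+1 *: \sum_(s < q1) act1 hs`_s (c gs (del s hs)).

Definition cocycle q c := cochain q c /\ forall gs hs, differential c gs hs = 0.

Definition coboundary q c :=
  if q is q'.+1 then
    exists2 b, cochain q' b & forall gs hs, c gs hs = differential b gs hs
  else forall gs hs, c gs hs = 0.

(* H^q(g; A) = Z^q / B^q is zero. *)
Definition cohomology_vanishes q := forall c, cocycle q c -> coboundary q c.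

End Cohomology.

Definition complete (K : fieldType) (g : lieSuperalgebra K) : Prop :=
  forall i, (i <= 2)%N -> cohomology_vanishes (adjoint g) i.

Section BilinearExt.

Variables (K : fieldType) (I J : finType) (V : lmodType K) (tab : I -> J -> V).

Definition bilinear_ext (u : {ffun I -> K^o}) (v : {ffun J -> K^o}) : V :=
  \sum_i \sum_j (u i * v j : K) *: tab i j.

Fact bilinear_ext_linearl v : linear (bilinear_ext^~ v).
Proof.
move=> a u u'; rewrite /bilinear_ext scaler_sumr -big_split /=.
apply: eq_bigr => i _; rewrite scaler_sumr -big_split /=.
apply: eq_bigr => j _; rewrite !ffunE mulrDl scalerDl scalerA.
by rewrite mulrA.
Qed.

Fact bilinear_ext_linearr u : linear (bilinear_ext u).
Proof.
move=> a v v'; rewrite /bilinear_ext scaler_sumr -big_split /=.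
apply: eq_bigr => i _; rewrite scaler_sumr -big_split /=.
apply: eq_bigr => j _; rewrite !ffunE mulrDr scalerDl scalerA.
by rewrite [X in X *: _ + _]mulrCA.
Qed.

Definition ffun_basis (i : I) : {ffun I -> K^o} := 
  [ffun i' => (i' == i)%:R : K].

Fact ffun_basis_sum (u : {ffun I -> K^o}) :
  u = \sum_i (u i : K) *: ffun_basis i.
Proof.
apply/ffunP => i; rewrite sum_ffunE (bigD1 i) //= !ffunE eqxx.
rewrite /GRing.scale /= mulr1 big1 ?addr0 // => j neq.
by rewrite !ffunE eq_sym (negbTE neq) /GRing.scale /= mulr0.
Qed.

Fact linear_eq_basis (f f' : {ffun I -> K^o} -> V) :
  linear f -> linear f' ->
  (forall i, f (ffun_basis i) = f' (ffun_basis i)) -> f =1 f'.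
Proof.
move=> fl f'l eqf u; rewrite [u]ffun_basis_sum (lin_sum fl) (lin_sum f'l).
by apply: eq_bigr => i _; rewrite (linZ fl) (linZ f'l) eqf.
Qed.

End BilinearExt.

Fact bilinear_ext_basis (K : fieldType) (I J : finType) (V : lmodType K) (tab : I -> J -> V)
    i j : bilinear_ext tab (ffun_basis K i) (ffun_basis K j) = tab i j.
Proof.
rewrite /bilinear_ext (bigD1 i) //= (bigD1 j) //= !ffunE !eqxx mulr1 scale1r.
rewrite big1 ?addr0 => [|j' neq]; last first.
  by rewrite !ffunE (negbTE neq) mulr0 scale0r.
rewrite big1 ?addr0 // => i' neq; rewrite big1 // => j' _.
by rewrite !ffunE (negbTE neq) mul0r scale0r.
Qed.

(* psum n j = n_1 + ... + n_j, where n_i is n at the ordinal i - 1. *)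
Definition psum (k : nat) (n : 'I_k -> nat) (j : nat) : nat :=
  \sum_(i < k | (i < j)%N) n i.

Fact psumS (k : nat) (n : 'I_k -> nat) (j : 'I_k) :
  psum n j.+1 = (psum n j + n j)%N.
Proof.
rewrite /psum (bigD1 j) ?ltnSn //= addnC; congr addn.
by apply: eq_bigl => i; rewrite ltnS [in RHS]ltn_neqAle andbC.
Qed.

Fact psum_le (k : nat) (n : 'I_k -> nat) i j :
  (i <= j)%N -> (psum n i <= psum n j)%N.
Proof.
move=> leij; rewrite /psum [leqLHS]big_mkcond [leqRHS]big_mkcond.
apply: leq_sum => l _; case: ifP => // lti.
by rewrite (leq_trans lti leij).
Qed.

Section SN.

Variables (K : fieldType) (k p : nat) (n : 'I_k -> nat) (m : 'I_p -> nat).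

Local Notation N := (psum n k).
Local Notation M := (psum m p).

(* Ordinals index the basis vectors: X_ i stands for x_(i+1), T_ r for t_(r+1),
   T'_ l for t'_(l+1), and b : 'I_M for y_(b+1). *)
Definition even_index : finType := ('I_N.+1 + ('I_k.+1 + 'I_p))%type.
Local Notation "'X_' i" := (inl i) (at level 8, only parsing).
Local Notation "'T_' r" := (inr (inl r)) (at level 8, only parsing).
Local Notation "'T'_' l" := (inr (inr l)) (at level 8, only parsing).

Definition SN_even : lmodType K := {ffun even_index -> K^o}.
Definition SN_odd : lmodType K := {ffun 'I_M -> K^o}.

(* x_a and y_b, numbered from 1; 0 when the index is out of range. *)
Definition SN_x (a : nat) : SN_even :=
  [ffun e : even_index => (if e is X_ i then (i.+1 == a)%:R else 0) : K].
Definition SN_y (b : nat) : SN_odd :=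
  [ffun i : 'I_M => (i.+1 == b)%:R : K].

(* x_a = x_(n_1 + ... + n_j + i) with 2 <= i <= n_(j+1) + 1, where j >= 0 is
   the ordinal j : 'I_k. *)
Definition x_block (j : 'I_k) (a : nat) : bool :=
  (psum n j + 2 <= a <= psum n j + n j + 1)%N.

(* Likewise with 2 <= i <= n_(j+1), for some j. *)
Definition x_step (a : nat) : bool :=
  [exists j : 'I_k, (psum n j + 2 <= a <= psum n j + n j)%N].

(* y_b = y_(m_1 + ... + m_j + i) with 1 <= i <= m_(j+1). *)
Definition y_block (j : 'I_p) (b : nat) : bool :=
  (psum m j + 1 <= b <= psum m j + m j)%N.

(* Likewise with 1 <= i <= m_(j+1) - 1, for some j. *)
Definition y_step (b : nat) : bool :=
  [exists j : 'I_p, (psum m j + 1 <= b <= psum m j + (m j).-1)%N].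

(* The eigenvalues of t_1, t_(j+2), t'_(j+1) on x_a and y_b. *)
Definition x_weight (r : 'I_k.+1 + 'I_p) (a : nat) : K :=
  match r with
  | inl r => if unlift ord0 r is Some j then (x_block j a)%:R else a%:R
  | inr _ => 0
  end.
Definition y_weight (r : 'I_k.+1 + 'I_p) (b : nat) : K :=
  match r with
  | inl r => if unlift ord0 r is Some _ then 0 else b%:R
  | inr j => (y_block j b)%:R
  end.

(* The brackets [e, f] of even basis vectors listed in the presentation; the
   full table on the basis is its skew-symmetrisation. *)
Definition listed00 (e f : even_index) : SN_even :=
  match e, f with
  | X_ i, X_ j => if (i == 0%N :> nat) && x_step j.+1 then SN_x j.+2 else 0
  | inr r, X_ j => x_weight r j.+1 *: SN_x j.+1
  | _, _ => 0
  end.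
Definition table00 (e f : even_index) : SN_even := listed00 e f - listed00 f e.

Definition table01 (e : even_index) (j : 'I_M) : SN_odd :=
  match e with
  | X_ i => if (i == 0%N :> nat) && y_step j.+1 then SN_y j.+2 else 0
  | inr r => y_weight r j.+1 *: SN_y j.+1
  end.

Definition SN_br00 : SN_even -> SN_even -> SN_even := bilinear_ext table00.
Definition SN_br01 : SN_even -> SN_odd -> SN_odd := bilinear_ext table01.
Definition SN_br11 (_ _ : SN_odd) : SN_even := 0.

Fact x_step_gt1 a : x_step a -> (1 < a)%N.
Proof. by case/existsP => j /andP[h _]; apply: leq_trans h; rewrite leq_addl. Qed.

Fact x_step_lt a : x_step a -> (a < N.+1)%N.
Proof.
case/existsP => j /andP[_ h]; rewrite ltnS (leq_trans h) // -psumS.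
exact: psum_le.
Qed.

Fact y_step_gt0 a : y_step a -> (0 < a)%N.
Proof. by case/existsP => j /andP[h _]; apply: leq_trans h; rewrite leq_addl. Qed.

Fact y_step_le a : y_step a -> (a <= M)%N.
Proof.
case/existsP => j /andP[_ h]; rewrite (leq_trans h) //.
by rewrite (@leq_trans (psum m j.+1)) ?psum_le // psumS leq_add2l leq_pred.
Qed.

Fact x_blockS a j : x_step a -> x_block j a.+1 = x_block j a.
Proof.
case/existsP => l /andP[h1 h2]; rewrite /x_block.
have [lt_jl | lt_lj | /val_inj eq_jl] := ltngtP j l.
- have le_jl := psum_le n lt_jl; rewrite psumS in le_jl.
  by apply/idP/idP => /andP[_ h3]; lia.
- have le_lj := psum_le n lt_lj; rewrite psumS in le_lj.
  by apply/idP/idP => /andP[h3 _]; lia.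
- by rewrite {j}eq_jl; lia.
Qed.

Fact y_blockS a j : y_step a -> y_block j a.+1 = y_block j a.
Proof.
case/existsP => l /andP[h1 h2]; rewrite /y_block.
have [lt_jl | lt_lj | /val_inj eq_jl] := ltngtP j l.
- have le_jl := psum_le m lt_jl; rewrite psumS in le_jl.
  by apply/idP/idP => /andP[_ h3]; lia.
- have le_lj := psum_le m lt_lj; rewrite psumS in le_lj.
  by apply/idP/idP => /andP[h3 _]; lia.
- by rewrite {j}eq_jl; lia.
Qed.

Fact x_weightS r a : x_step a -> x_weight r a.+1 = x_weight r 1 + x_weight r a.
Proof.
move=> st; case: r => [r|l] /=; last by rewrite addr0.
case: unliftP => [j _|_]; last by rewrite -natr1 addrC.
by rewrite x_blockS // /x_block addn2 ltnS ltn0 /= add0r.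
Qed.

Fact y_weightS r a : y_step a -> y_weight r a.+1 = x_weight r 1 + y_weight r a.
Proof.
move=> st; case: r => [r|l] /=; last by rewrite y_blockS // add0r.
case: unliftP => [j _|_]; last by rewrite -natr1 addrC.
by rewrite /x_block addn2 ltnS ltn0 /= add0r.
Qed.

Definition SN_t (r : 'I_k.+1 + 'I_p) : SN_even := ffun_basis K (inr r).

Fact SN_x_basis (i : 'I_N.+1) : ffun_basis K (inl i : even_index) = SN_x i.+1.
Proof. by apply/ffunP => -[i'|r]; rewrite !ffunE ?eqSS. Qed.

Fact SN_y_basis (i : 'I_M) : ffun_basis K i = SN_y i.+1.
Proof. by apply/ffunP => i'; rewrite !ffunE ?eqSS. Qed.

Fact SN_x_range a :
  (exists i : 'I_N.+1, a = i.+1) \/ SN_x a = 0 /\ (a == 0%N) || (N.+1 < a)%N.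
Proof.
case: a => [|a].
  by right; split=> //; apply/ffunP => -[i|r]; rewrite !ffunE.
have [lt_a|le_a] := ltnP a N.+1; first by left; exists (Ordinal lt_a).
right; split=> //; apply/ffunP => -[i|r]; rewrite !ffunE // eqSS.
by rewrite ltn_eqF // (leq_trans _ le_a).
Qed.

Fact SN_y_range a :
  (exists i : 'I_M, a = i.+1) \/ SN_y a = 0 /\ (a == 0%N) || (M < a)%N.
Proof.
case: a => [|a].
  by right; split=> //; apply/ffunP => i; rewrite !ffunE.
have [lt_a|le_a] := ltnP a M; first by left; exists (Ordinal lt_a).
right; split=> //; apply/ffunP => i; rewrite !ffunE // eqSS.
by rewrite ltn_eqF // (leq_trans _ le_a).
Qed.

Fact SN_br00_linearl v : linear (SN_br00^~ v).
Proof. exact: bilinear_ext_linearl. Qed.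
Fact SN_br00_linearr u : linear (SN_br00 u).
Proof. exact: bilinear_ext_linearr. Qed.
Fact SN_br01_linearl v : linear (SN_br01^~ v).
Proof. exact: bilinear_ext_linearl. Qed.
Fact SN_br01_linearr u : linear (SN_br01 u).
Proof. exact: bilinear_ext_linearr. Qed.

Let br000l v := lin0 (SN_br00_linearl v).
Let br000r u := lin0 (SN_br00_linearr u).
Let br010l v := lin0 (SN_br01_linearl v).
Let br010r u := lin0 (SN_br01_linearr u).

Definition x_delta (a b : nat) : K := ((a == 1%N) && x_step b)%:R.
Definition y_delta (a b : nat) : K := ((a == 1%N) && y_step b)%:R.

Fact x_delta_out a b :
  (b == 0%N) || (N.+1 < b)%N -> x_delta a b = 0.
Proof.
rewrite /x_delta => out; case st: (x_step b); rewrite ?andbF //.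
by have := x_step_gt1 st; have := x_step_lt st; lia.
Qed.

Fact y_delta_out a b : (b == 0%N) || (M < b)%N -> y_delta a b = 0.
Proof.
rewrite /y_delta => out; case st: (y_step b); rewrite ?andbF //.
by have := y_step_gt0 st; have := y_step_le st; lia.
Qed.

Fact x_delta_out1 a b : (a == 0%N) || (N.+1 < a)%N -> x_delta a b = 0.
Proof. by rewrite /x_delta; case: (a =P 1%N) => // ->. Qed.

Fact y_delta_out1 a b : (a == 0%N) || (N.+1 < a)%N -> y_delta a b = 0.
Proof. by rewrite /y_delta; case: (a =P 1%N) => // ->. Qed.

Fact SN_brxx a b : SN_br00 (SN_x a) (SN_x b) =
  x_delta a b *: SN_x b.+1 - x_delta b a *: SN_x a.+1.
Proof.
case: (SN_x_range a) => [[i ->]|[-> out]]; last first.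
  by rewrite br000l x_delta_out1 // x_delta_out // !scale0r subrr.
case: (SN_x_range b) => [[j ->]|[-> out]]; last first.
  by rewrite br000r x_delta_out // x_delta_out1 // !scale0r subrr.
rewrite -!SN_x_basis /SN_br00 bilinear_ext_basis /table00 /= /x_delta !eqSS.
by congr (_ - _); case: ifP => _; rewrite ?scale1r ?scale0r.
Qed.

Fact SN_brtx r a : SN_br00 (SN_t r) (SN_x a) = x_weight r a *: SN_x a.
Proof.
case: (SN_x_range a) => [[i ->]|[-> out]]; last by rewrite br000r scaler0.
by rewrite -SN_x_basis /SN_br00 bilinear_ext_basis /table00 /= subr0 SN_x_basis.
Qed.

Fact SN_brxt r a : SN_br00 (SN_x a) (SN_t r) = - (x_weight r a *: SN_x a).
Proof.
case: (SN_x_range a) => [[i ->]|[-> out]]; last by rewrite br000l scaler0 oppr0.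
by rewrite -SN_x_basis /SN_br00 bilinear_ext_basis /table00 /= sub0r SN_x_basis.
Qed.

Fact SN_brtt r r' : SN_br00 (SN_t r) (SN_t r') = 0.
Proof. by rewrite /SN_br00 bilinear_ext_basis /table00 /= subr0. Qed.

Fact SN_brxy a b : SN_br01 (SN_x a) (SN_y b) = y_delta a b *: SN_y b.+1.
Proof.
case: (SN_x_range a) => [[i ->]|[-> out]]; last first.
  by rewrite br010l y_delta_out1 // scale0r.
case: (SN_y_range b) => [[j ->]|[-> out]]; last first.
  by rewrite br010r y_delta_out // scale0r.
rewrite -SN_x_basis -SN_y_basis /SN_br01 bilinear_ext_basis /= /y_delta !eqSS.
by case: ifP => _; rewrite ?scale1r ?scale0r.
Qed.

Fact SN_brty r b : SN_br01 (SN_t r) (SN_y b) = y_weight r b *: SN_y b.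
Proof.
case: (SN_y_range b) => [[i ->]|[-> out]]; last by rewrite br010r scaler0.
by rewrite -SN_y_basis /SN_br01 bilinear_ext_basis /= SN_y_basis.
Qed.


Fact linear_comb (U V : lmodType K) (f f' : U -> V) :
  linear f -> linear f' -> linear (fun u => f u + f' u).
Proof.
by move=> fl f'l a u v; rewrite fl f'l scalerDr addrACA.
Qed.

Fact linear_comp (U V W : lmodType K) (f : V -> W) (f' : U -> V) :
  linear f -> linear f' -> linear (fun u => f (f' u)).
Proof. by move=> fl f'l a u v; rewrite f'l fl. Qed.

Let br00Zl v := linZ (SN_br00_linearl v).
Let br00Zr u := linZ (SN_br00_linearr u).
Let br00Nl v := linN (SN_br00_linearl v).
Let br00Nr u := linN (SN_br00_linearr u).
Let br00Dl v := linD (SN_br00_linearl v).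
Let br00Dr u := linD (SN_br00_linearr u).
Let br01Zr u := linZ (SN_br01_linearr u).

Fact SN_br00_skew u v : SN_br00 u v = - SN_br00 v u.
Proof.
move: u v => /[swap] v; apply: linear_eq_basis.
- exact: SN_br00_linearl.
- by move=> a u u'; rewrite SN_br00_linearr opprD scalerN.
move=> i; move: v; apply: linear_eq_basis.
- exact: SN_br00_linearr.
- by move=> a u u'; rewrite SN_br00_linearl opprD scalerN.
by move=> j; rewrite /SN_br00 !bilinear_ext_basis /table00 opprB.
Qed.

Fact SN_br00_basis_ind (P : SN_even -> Prop) :
  (forall a, P (SN_x a)) -> (forall r, P (SN_t r)) ->
  forall e : even_index, P (ffun_basis K e).
Proof. by move=> Px Pt [i|r]; [rewrite SN_x_basis | apply: Pt]. Qed.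

Let jac a b c :=
  SN_br00 a (SN_br00 b c) = SN_br00 (SN_br00 a b) c + SN_br00 b (SN_br00 a c).

Let jac_swap a b c : jac a b c -> jac b a c.
Proof.
rewrite /jac => ->; rewrite (SN_br00_skew b a) br00Nl.
by rewrite addKr.
Qed.

Let jac_rot a b c : jac a b c -> jac a c b.
Proof.
rewrite /jac (SN_br00_skew b c) br00Nr => /(congr1 -%R).
rewrite opprK => ->; rewrite opprD addrC.
by rewrite (SN_br00_skew (SN_br00 a c)) (SN_br00_skew c (SN_br00 a b)).
Qed.

Let jac_xxx a b c : jac (SN_x a) (SN_x b) (SN_x c).
Proof.
rewrite /jac !SN_brxx !(br00Dr, br00Dl, br00Nr, br00Nl, br00Zr, br00Zl).
rewrite !SN_brxx /x_delta.
have st1 : x_step 1 = false by apply/negbTE/negP => /x_step_gt1.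
have z a' b' v :
    (x_step a')%:R *: (((a' == 0%N) && x_step b')%:R *: v : SN_even) = 0.
  case st: (x_step a'); last by rewrite scale0r.
  by have := x_step_gt1 st; case: a' {st} => // a' _; rewrite scale0r scaler0.
rewrite !eqSS.
case: (a =P 1%N) => [->|_]; case: (b =P 1%N) => [->|_];
  case: (c =P 1%N) => [->|_];
  rewrite ?st1 ?andbF ?andFb /= ?(scale0r, subr0, sub0r, oppr0, scaler0, addr0, add0r) //.
all: by rewrite !(scalerN, opprK, z, oppr0, addr0, subrr).
Qed.

Let jac_txx r b c : jac (SN_t r) (SN_x b) (SN_x c).
Proof.
rewrite /jac !(SN_brxx, SN_brtx) !(br00Dr, br00Dl, br00Nr, br00Nl, br00Zr, br00Zl).
rewrite !(SN_brtx, SN_brxx) -scalerDl.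
rewrite scalerBr !scalerA; congr (_ - _); rewrite /x_delta.
  case: (b =P 1%N) => [->|_]; last by rewrite !(mul0r, mulr0).
  case st: (x_step c); last by rewrite !(mul0r, mulr0).
  by rewrite x_weightS // mulrC.
case: (c =P 1%N) => [->|_]; last by rewrite !(mul0r, mulr0).
case st: (x_step b); last by rewrite !(mul0r, mulr0).
by rewrite x_weightS // mulrC addrC.
Qed.

Let jac_ttx r s c : jac (SN_t r) (SN_t s) (SN_x c).
Proof.
rewrite /jac SN_brtt br000l !SN_brtx !br00Zr !SN_brtx !scalerA add0r.
by rewrite mulrC.
Qed.

Let jac_ttt r s t : jac (SN_t r) (SN_t s) (SN_t t).
Proof. by rewrite /jac !SN_brtt !br000l !br000r addr0. Qed.

Fact SN_jacobi000 a b c :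
  SN_br00 a (SN_br00 b c) = SN_br00 (SN_br00 a b) c + SN_br00 b (SN_br00 a c).
Proof.
have l := SN_br00_linearl; have r := SN_br00_linearr.
move: a b c => /[swap] b /[swap] c; apply: linear_eq_basis.
- exact: l.
- exact: linear_comb (linear_comp (l c) (l b)) (linear_comp (r b) (l c)).
move=> e; move: b; apply: linear_eq_basis.
- exact: linear_comp (r _) (l c).
- exact: linear_comb (linear_comp (l c) (r _)) (l _).
move=> f; move: c; apply: linear_eq_basis.
- exact: linear_comp (r _) (r _).
- exact: linear_comb (r _) (linear_comp (r _) (r _)).
move=> h.
suff: jac (ffun_basis K e) (ffun_basis K f) (ffun_basis K h) by [].
move: e; apply: (@SN_br00_basis_ind (fun u => jac u _ _)) => e;
  move: f; apply: (@SN_br00_basis_ind (fun u => jac _ u _)) => f;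
  move: h; apply: (@SN_br00_basis_ind (fun u => jac _ _ u)) => h.
- exact: jac_xxx.
- by apply/jac_rot/jac_swap/jac_txx.
- exact/jac_swap/jac_txx.
- exact/jac_swap/jac_rot/jac_ttx.
- exact: jac_txx.
- exact/jac_rot/jac_ttx.
- exact: jac_ttx.
- exact: jac_ttt.
Qed.

Fact SN_jacobi001 a b h :
  SN_br01 a (SN_br01 b h) = SN_br01 (SN_br00 a b) h + SN_br01 b (SN_br01 a h).
Proof.
have l := SN_br00_linearl; have r := SN_br00_linearr.
have l1 := SN_br01_linearl; have r1 := SN_br01_linearr.
move: a b h => /[swap] b /[swap] h; apply: linear_eq_basis.
- exact: l1.
- exact: linear_comb (linear_comp (l1 h) (l b)) (linear_comp (r1 b) (l1 h)).
move=> e; move: b; apply: linear_eq_basis.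
- exact: linear_comp (r1 _) (l1 h).
- exact: linear_comb (linear_comp (l1 h) (r _)) (l1 _).
move=> f; move: h; apply: linear_eq_basis.
- exact: linear_comp (r1 _) (r1 _).
- exact: linear_comb (r1 _) (linear_comp (r1 _) (r1 _)).
move=> h; rewrite SN_y_basis; move: (h.+1) => {}h.
pose jac' a b := SN_br01 a (SN_br01 b (SN_y h)) =
  SN_br01 (SN_br00 a b) (SN_y h) + SN_br01 b (SN_br01 a (SN_y h)).
suff: jac' (ffun_basis K e) (ffun_basis K f) by [].
move: e; apply: (@SN_br00_basis_ind (fun u => jac' u _)) => e;
  move: f; apply: (@SN_br00_basis_ind (jac' _)) => f; rewrite /jac'.
- rewrite SN_brxx (linD (l1 _)) (linN (l1 _)) !(linZ (l1 _)).
  rewrite !SN_brxy !br01Zr !SN_brxy !scalerA /x_delta /y_delta.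
  have st1 : x_step 1 = false by apply/negbTE/negP => /x_step_gt1.
  have z a' : (x_step a')%:R * (((a' == 0%N) && y_step h)%:R : K) = 0.
    case st: (x_step a'); last by rewrite mul0r.
    by have := x_step_gt1 st; case: a' {st} => // a' _; rewrite mulr0.
  rewrite !eqSS.
  case: (e =P 1%N) => [->|_]; case: (f =P 1%N) => [->|_];
    rewrite ?st1 ?andbF ?andFb /= ?z;
    by rewrite !(mul0r, mulr0, scale0r, oppr0, addr0, add0r).
- rewrite SN_brxt (linN (l1 _)) (linZ (l1 _)) SN_brty !SN_brxy !br01Zr !SN_brty.
  rewrite SN_brxy !scalerA -scaleNr -scalerDl; congr (_ *: _).
  rewrite /y_delta; case: (e =P 1%N) => [->|_]; last by rewrite !(mul0r, mulr0, oppr0, addr0).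
  case st: (y_step h); last by rewrite !(mul0r, mulr0, oppr0, addr0).
  by rewrite y_weightS // !mulr1 mul1r addKr.
- rewrite SN_brtx (linZ (l1 _)) SN_brty !SN_brxy !br01Zr !SN_brty.
  rewrite SN_brxy !scalerA -scalerDl; congr (_ *: _).
  rewrite /y_delta; case: (f =P 1%N) => [->|_]; last by rewrite !(mul0r, mulr0, addr0).
  case st: (y_step h); last by rewrite !(mul0r, mulr0, addr0).
  by rewrite y_weightS // !mulr1 mul1r.
- rewrite SN_brtt (lin0 (l1 _)) !SN_brty !br01Zr !SN_brty !scalerA add0r.
  by rewrite mulrC.
Qed.

Fact SN_br11_linearl v : linear (SN_br11^~ v).
Proof. by move=> a u u'; rewrite /SN_br11 scaler0 addr0. Qed.

Fact SN_br11_linearr u : linear (SN_br11 u).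
Proof. by move=> a v v'; rewrite /SN_br11 scaler0 addr0. Qed.

Fact SN_br11_sym u v : SN_br11 u v = SN_br11 v u.
Proof. by []. Qed.

Fact SN_jacobi011 a h h' :
  SN_br00 a (SN_br11 h h') = SN_br11 (SN_br01 a h) h' + SN_br11 h (SN_br01 a h').
Proof. by rewrite /SN_br11 br000r addr0. Qed.

Fact SN_jacobi111 h1 h2 h3 :
  - SN_br01 (SN_br11 h2 h3) h1 =
  SN_br01 (SN_br11 h1 h2) h3 + SN_br01 (SN_br11 h1 h3) h2.
Proof. by rewrite /SN_br11 !br010l oppr0 addr0. Qed.

Definition SN : lieSuperalgebra K :=
  LieSuperalgebra SN_br00_linearl SN_br00_linearr
    SN_br01_linearl SN_br01_linearr SN_br11_linearl SN_br11_linearr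
    SN_br00_skew SN_br11_sym
    SN_jacobi000 SN_jacobi001 SN_jacobi011 SN_jacobi111.

End SN.

(* Main.v *)
Require Import Defs.
From mathcomp Require Import all_boot all_algebra zify ring.

(** The algebra SN is N + T, where the torus T (spanned by the t_r and the t'_l)
    acts diagonally on the nilpotent part N (spanned by the x_a and the y_b).
    Cochains with adjoint coefficients therefore split into weight spaces for T,
    a coordinate being an assignment of output basis vectors to input basis
    vectors, of weight wt(output) - wt(inputs).

    Nonzero weights contribute nothing.  For a cocycle c, the Cartan homotopy
    formula says that the t_r-weight times c is, up to sign, the coboundary of the
    contraction c(t_r, -).  Choosing for each nonzero weight mu some r with
    mu(r) <> 0, and dividing by mu(r), gives one cochain whose coboundary is the
    part of c of nonzero weight ([cobound0_contract], [cobound1_contract]).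

    Weight zero leaves very few coordinates.  In characteristic 0 the weights of
    the basis vectors of N are distinct and nonzero, and a sum of two of them is
    a weight only for x_1 and a vector that x_1 moves one step along its block
    ([wt_inj], [wt_add]).  The coordinates left in degree 2 are those of
    c(t_r, t_s) in T, of c(t_r, u) along u and of c(x_1, u) along [x_1, u].
    - The last ones are the increments of a function along the blocks, hence the
      coboundary of a diagonal cochain on N ([next_potential]).
    - The cocycle identity at (t_r, x_1, u) makes u |-> c(t_r, u)_u additive
      along the blocks.  As N has as many generators as T has dimensions, such a
      function is a combination of the weights, and so these coordinates are
      the coboundary of a map T -> T ([additive_is_torus]).
    - The cocycle identity at (t_r, t_s, u) says that the weight of u vanishes on
      c(t_r, t_s), which is therefore 0 ([torus_faithful]).
    Degree 1 uses the last two points once more (a derivation of weight zero of N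
    comes from T), and degree 0 says that T acts faithfully on N.

    All of this is done on coordinates, for pairs of basis vectors in which an
    odd one never precedes an even one ([ordered]); the bracket of two odd
    elements being zero, a single array of structure constants then serves both
    parities. *)

Set Implicit Arguments.
Unset Strict Implicit.
Unset Printing Implicit Defensive.

Import GRing.Theory.
Local Open Scope ring_scope.

(** * Contraction by a diagonalizable torus *)

Section TorusContraction.

Variables (K : fieldType) (I R : finType) (odd : pred I).
Variables (s : I -> I -> I -> K) (tor : R -> I) (wt : R -> I -> K).

(** The coordinates of d v(e_i) = - e_i . v and, below, of
    d b(e_i, e_j) = b([e_i, e_j]) - e_i . b(e_j) +- e_j . b(e_i), when s holds
    the structure constants and the module is adjoint; the sign is minus exactly
    when e_i and e_j are both odd. *)
Definition cobound0 (v : I -> K) (i f : I) : K := - \sum_l s i l f * v l.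

Definition cobound1 (b : I -> I -> K) (i j f : I) : K :=
  \sum_l s i j l * b l f - \sum_l s i l f * b j l
  + (-1) ^+ (odd i && odd j) * \sum_l s j l f * b i l.

(** The homotopy: F r is a coordinate of c(t_r, -), and mu is its weight.  The
    chosen r depends on mu alone, so that all terms of a coboundary, which share
    the same mu, are divided by the same scalar. *)
Definition contract (mu : {ffun R -> K}) (F : R -> K) : K :=
  if [pick r | mu r != 0] is Some r then - (mu r)^-1 * F r else 0.

Lemma contractE (mu : {ffun R -> K}) (F : R -> K) (c : K) :
  (forall r, mu r * c = - F r) -> mu != 0 -> contract mu F = c.
Proof.
move=> muc mu_n0; rewrite /contract; case: pickP => [r mur|mu0].
  by rewrite mulNr -mulrN -muc mulKf.
by case/eqP: mu_n0; apply/ffunP => r; have /negbFE/eqP-> := mu0 r; rewrite ffunE.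
Qed.

Lemma contract0 (F : R -> K) : contract 0 F = 0.
Proof. by rewrite /contract; case: pickP => // r; rewrite ffunE eqxx. Qed.

Hypothesis homogeneous :
  forall i j f, s i j f != 0 -> forall r, wt r f = wt r i + wt r j.

Definition defect0 f := [ffun r => wt r f].
Definition defect1 i f := [ffun r => wt r f - wt r i].
Definition defect2 i j f := [ffun r => wt r f - wt r i - wt r j].

(** The hypothesis is the Cartan formula for the torus element r: the torus acts
    on the cocycle D through the contraction of D by that element.  The case of
    weight zero is part of the conclusion because the homotopy vanishes there. *)
Lemma cobound0_contract (D : I -> I -> K) i f :
    (forall r, defect1 i f r * D i f = - cobound0 (D (tor r)) i f) ->
  cobound0 (fun l => contract (defect0 l) (fun r => D (tor r) l)) i f
  = if defect1 i f == 0 then 0 else D i f.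
Proof.
move=> cartan; transitivity
    (contract (defect1 i f) (fun r => cobound0 (D (tor r)) i f)); last first.
  case: eqP => [->|/eqP n0]; first exact: contract0.
  by exact: contractE.
have defl l : s i l f != 0 -> defect0 l = defect1 i f.
  by move=> /homogeneous wtf; apply/ffunP => r; rewrite !ffunE wtf addrC addKr.
rewrite /cobound0; under eq_bigr => l _.
  have -> : s i l f * contract (defect0 l) (fun r => D (tor r) l)
          = s i l f * contract (defect1 i f) (fun r => D (tor r) l).
    by have [->|/defl->//] := eqVneq (s i l f) 0; rewrite !mul0r.
  over.
rewrite /contract; case: pickP => [r _|_].
  rewrite mulrN mulr_sumr; congr (- _).
  by apply: eq_bigr => l _; rewrite mulrCA.
by rewrite big1 ?oppr0 // => l _; rewrite mulr0.
Qed.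

(** The three terms of the coboundary meet the homotopy at different pairs, but
    at pairs of the same weight whenever the structure constant in front is
    nonzero, because brackets add weights. *)
Lemma cobound1_contract (C : I -> I -> I -> K) i j f :
    (forall r, defect2 i j f r * C i j f = - cobound1 (C (tor r)) i j f) ->
  cobound1 (fun l h => contract (defect1 l h) (fun r => C (tor r) l h)) i j f
  = if defect2 i j f == 0 then 0 else C i j f.
Proof.
move=> cartan; transitivity
    (contract (defect2 i j f) (fun r => cobound1 (C (tor r)) i j f)); last first.
  case: eqP => [->|/eqP n0]; first exact: contract0.
  by exact: contractE.
have cE a l h : (a != 0 -> defect1 l h = defect2 i j f) ->
    a * contract (defect1 l h) (fun r => C (tor r) l h)
    = a * contract (defect2 i j f) (fun r => C (tor r) l h).
  by move=> defE; have [->|/defE-> //] := eqVneq a 0; rewrite !mul0r.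
rewrite /cobound1.
under eq_bigr => l _.
  rewrite cE; last first.
    by move=> /homogeneous wtf; apply/ffunP => r; rewrite !ffunE wtf; ring.
  over.
under [X in _ - X]eq_bigr => l _.
  rewrite cE; last first.
    by move=> /homogeneous wtf; apply/ffunP => r; rewrite !ffunE wtf; ring.
  over.
under [X in _ + _ * X]eq_bigr => l _.
  rewrite cE; last first.
    by move=> /homogeneous wtf; apply/ffunP => r; rewrite !ffunE wtf; ring.
  over.
rewrite /contract; case: pickP => [r _|_].
  have sumE (G H : I -> K) :
      \sum_l G l * (- (defect2 i j f r)^-1 * H l)
      = - (defect2 i j f r)^-1 * \sum_l G l * H l.
    by rewrite mulr_sumr; apply: eq_bigr => l _; rewrite mulrCA.
  by rewrite !sumE; ring.
have sum0 (G : I -> K) : \sum_l G l * 0 = 0 by rewrite -mulr_suml mulr0.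
by rewrite !sum0 subr0 mulr0 addr0.
Qed.

End TorusContraction.

(** * Blocks of the basis of the nilradical *)

Lemma psum_interval_ex (q : nat) (n : 'I_q -> nat) c :
  (c < psum n q)%N -> exists j : 'I_q, (psum n j <= c < psum n j + n j)%N.
Proof.
move=> ltc; have exj : exists t, (c < psum n t)%N by exists q.
case: (ex_minnP exj) => t ltct mint; have letq := mint _ ltc.
case: t => [|t] in ltct mint letq *.
  by rewrite /psum big_pred0 in ltct.
exists (Ordinal letq); rewrite -psumS /= ltct andbT leqNgt.
by apply/negP => /mint; rewrite ltnn.
Qed.

Lemma psum_interval_uniq (q : nat) (n : 'I_q -> nat) c (i j : 'I_q) :
  (psum n i <= c < psum n i + n i)%N -> (psum n j <= c < psum n j + n j)%N ->
  i = j.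
Proof.
move=> /andP[i1 i2] /andP[j1 j2]; apply: val_inj.
have [lt_ij|lt_ji|//] := ltngtP i j.
  by have := psum_le n lt_ij; rewrite psumS; lia.
by have := psum_le n lt_ji; rewrite psumS; lia.
Qed.

Lemma psum_interval_lt (q : nat) (n : 'I_q -> nat) (j : 'I_q) :
  (psum n j + n j <= psum n q)%N.
Proof. by rewrite -psumS psum_le. Qed.

Lemma constant_on_interval (T : Type) (L lo hi : nat) (h : 'I_L -> T) :
    (forall i i' : 'I_L, (lo <= i < hi)%N -> (lo <= i' < hi)%N ->
       i' = i.+1 :> nat -> h i' = h i) ->
  forall i i' : 'I_L, (lo <= i < hi)%N -> (lo <= i' < hi)%N -> h i = h i'.
Proof.
move=> hS.
have up d (i i' : 'I_L) : (lo <= i < hi)%N -> (lo <= i' < hi)%N ->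
    i' = (i + d)%N :> nat -> h i = h i'.
  elim: d i' => [|d IHd] i' ini ini' i'E.
    by congr h; apply: val_inj; rewrite /= i'E addn0.
  have ltd : (i + d < L)%N by have := ltn_ord i'; lia.
  rewrite (IHd (Ordinal ltd)) //=; last by lia.
  by symmetry; apply: hS => //=; lia.
move=> i i' ini ini'; have [le_ii'|le_i'i] := leqP i i'.
  by apply: (up (i' - i)%N) => //; lia.
by symmetry; apply: (up (i - i')%N) => //; lia.
Qed.

Lemma ordinal_potential (V : nmodType) (L : nat) (F : 'I_L -> 'I_L -> V) :
  exists g : 'I_L -> V, (forall i : 'I_L, i = 0%N :> nat -> g i = 0) /\
    forall i j : 'I_L, j = i.+1 :> nat -> g j = g i + F i j.
Proof.
pose G := fix G (c : nat) : V := if c is c'.+1 then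
  G c' + (if (insub c', insub c) is (Some i, Some j) then F i j else 0) else 0.
exists (fun i => G i); split=> [i -> //|i j jE].
rewrite jE /= -jE; congr (_ + _).
by rewrite !valK.
Qed.

Section SNConstants.

Variables (K : fieldType) (k p : nat) (n : 'I_k -> nat) (m : 'I_p -> nat).

Definition SN_index : finType := (even_index p n + 'I_(psum m p))%type.
Definition torus_index : finType := ('I_k.+1 + 'I_p)%type.

Local Notation I := SN_index.
Local Notation R := torus_index.

Definition odd_index (i : I) : bool := if i is inr _ then true else false.
Definition tor (r : R) : I := inl (inr r).
Definition nil_index (i : I) : bool := if i is inl (inr _) then false else true.
Definition x1 : I := inl (inl ord0).
Definition t1 : R := inl ord0.

(** The weight of t_1, as a natural number. *)
Definition pos (i : I) : nat :=
  match i with inl (inl a) => a.+1 | inl (inr _) => 0 | inr b => b.+1 end.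

(** For r other than t_1, the block r is the set of basis vectors of N on which
    the torus element r is the identity.  The block of t_1 is empty, so that
    distinct indices always have disjoint blocks. *)
Definition in_block (r : R) (i : I) : bool :=
  match r, i with
  | inl r, inl (inl a) =>
      if unlift ord0 r is Some j then x_block n j a.+1 else false
  | inr l, inr b => y_block m l b.+1
  | _, _ => false
  end.

(** [x_1, e_i] = e_f, read off from blocks and positions; [next_xE] and
    [next_yE] compare it with the steps of the multiplication table. *)
Definition next (i f : I) : bool :=
  (pos f == (pos i).+1) && [exists r, in_block r i && in_block r f].

Definition wt (r : R) (i : I) : K :=
  match i with
  | inl (inl a) => x_weight K n r a.+1
  | inl (inr _) => 0
  | inr b => y_weight K m r b.+1
  end.

(** Structure constants of the whole superalgebra; as odd elements bracket to
    zero, the array is skew in i and j without signs. *)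
Definition SN_sc (i j f : I) : K :=
  match i, j, f with
  | inl e, inl e', inl f => (table00 K e e' : {ffun _ -> K^o}) f
  | inl e, inr b, inr f => (table01 K e b : {ffun _ -> K^o}) f
  | inr b, inl e, inr f => - (table01 K e b : {ffun _ -> K^o}) f
  | _, _, _ => 0
  end.

Lemma wtE r i : wt r i = (if r == t1 then pos i else in_block r i : nat)%:R.
Proof.
have lift_t1 j : (inl (lift ord0 j) == t1 :> R) = false by apply/eqP => -[].
case: i => [[a|s]|b] /=; case: r => [r|l] //=; try by case: ifP.
  by case: unliftP => [j|] ->; rewrite ?lift_t1 ?eqxx.
by case: unliftP => [j|] ->; rewrite ?lift_t1 ?eqxx.
Qed.

Lemma in_block_t1 i : in_block t1 i = false.
Proof. by case: i => [[a|s]|b] //=; rewrite unlift_none. Qed.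

Lemma in_block_x1 r : in_block r x1 = false.
Proof. by case: r => [r|l] //=; case: unlift => // j; rewrite /x_block; lia. Qed.

Lemma x_blockE j a :
  x_block n j a.+2 = (psum n j <= a < psum n j + n j)%N.
Proof. by rewrite /x_block; lia. Qed.

Lemma y_blockE j a :
  y_block m j a.+1 = (psum m j <= a < psum m j + m j)%N.
Proof. by rewrite /y_block; lia. Qed.

Lemma in_block_uniq r r' i : in_block r i -> in_block r' i -> r = r'.
Proof.
case: i r r' => [[[[|a] lta]|s]|b] [r|l] [r'|l'] //=.
- by case: unlift => // j; rewrite /x_block; lia.
- case: unliftP => // j ->; case: unliftP => // j' ->; rewrite !x_blockE.
  by move=> jin /(psum_interval_uniq jin) ->.
- by rewrite !y_blockE => lin /(psum_interval_uniq lin) ->.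
Qed.

Lemma in_block_ex i : nil_index i -> i != x1 -> exists r, in_block r i.
Proof.
case: i => [[[[|a] lta]|s]|b] //= _.
- have [j jin] := psum_interval_ex lta.
  by exists (inl (lift ord0 j)); rewrite /= liftK x_blockE.
have [j jin] := psum_interval_ex (ltn_ord b).
by exists (inr j); rewrite /= y_blockE.
Qed.

Lemma in_block_pos_inj r i f :
  in_block r i -> in_block r f -> pos i = pos f -> i = f.
Proof.
case: r i f => [r|l] [[a|s]|b] [[a'|s']|b'] //= _ _ [eq_ab].
  by rewrite (val_inj eq_ab).
by rewrite (val_inj eq_ab).
Qed.

Lemma in_block_start : (forall j, (1 <= n j)%N) -> (forall j, (1 <= m j)%N) ->
  forall r, r != t1 -> exists i, in_block r i.
Proof.
move=> hn hm [r|l].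
  case: (unliftP ord0 r) => [j ->|->]; last by rewrite eqxx.
  move=> _; have lt_j : ((psum n j).+1 < (psum n k).+1)%N.
    rewrite ltnS (leq_trans _ (psum_interval_lt n j)) //.
    by rewrite -[ltnLHS]addn0 ltn_add2l.
  exists (inl (inl (Ordinal lt_j))); rewrite /= liftK x_blockE /=.
  by rewrite leqnn -[ltnLHS]addn0 ltn_add2l hn.
move=> _; have lt_l : (psum m l < psum m p)%N.
  by have := psum_interval_lt m l; have := hm l; lia.
exists (inr (Ordinal lt_l)); rewrite /= y_blockE /= leqnn.
by rewrite -[ltnLHS]addn0 ltn_add2l hm.
Qed.

(** A block is an interval of successive indices, so a function that does not
    change along steps is constant on it. *)
Lemma in_block_const (T : Type) (h : I -> T) :
    (forall i f, next i f -> h f = h i) ->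
  forall r i f, in_block r i -> in_block r f -> h i = h f.
Proof.
move=> hS [r|l] [[a|s]|b] [[a'|s']|b'] //=.
- case: unliftP => // j rE; have xbE (c : 'I_(psum n k).+1) :
    x_block n j c.+1 = ((psum n j).+1 <= c < (psum n j + n j).+1)%N.
    by rewrite /x_block addn2 addn1.
  rewrite !xbE; move: a a'; apply: (constant_on_interval (h := h \o inl \o inl)).
  move=> i i' ini ini' i'E /=; apply: hS.
  apply/andP; split; first by rewrite /= i'E.
  by apply/existsP; exists (inl r); rewrite /= rE liftK !xbE ini.
- rewrite !y_blockE.
  move: b b'; apply: (constant_on_interval (h := h \o inr)).
  move=> i i' ini ini' i'E /=; apply: hS.
  apply/andP; split; first by rewrite /= i'E.
  by apply/existsP; exists (inr l); rewrite /= !y_blockE ini.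
Qed.

(** The steps form disjoint paths, and none of them meets x_1: any increments can
    be integrated, with the value at x_1 left free. *)
Lemma next_potential (F : I -> I -> K) :
  exists g : I -> K, g x1 = 0 /\ forall i f, next i f -> g f = g i + F i f.
Proof.
have [gx [gx0 gxS]] :=
  ordinal_potential (fun a b => F (inl (inl a)) (inl (inl b))).
have [gy [_ gyS]] := ordinal_potential (fun a b => F (inr a) (inr b)).
exists (fun i => match i with inl (inl a) => gx a | inr b => gy b | _ => 0 end).
split=> [|i f /andP[/eqP posE /existsP[r /andP[]]]]; first exact: gx0.
case: r i f posE => [r|l] [[a|s]|b] [[a'|s']|b'] //= [posE] _ _.
  exact: gxS.
exact: gyS.
Qed.

Lemma next_neq_x1 i f : next i f -> (i == x1 = false) * (f == x1 = false).
Proof.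
move=> /andP[_ /existsP[r /andP[ri rf]]]; split; apply/negP => /eqP iE.
  by rewrite iE in_block_x1 in ri.
by rewrite iE in_block_x1 in rf.
Qed.

Lemma next_nil i f : next i f -> nil_index i /\ nil_index f.
Proof.
move=> /andP[_ /existsP[r /andP[]]].
by case: r i f => [r|l] [[a|s]|b] [[a'|s']|b'].
Qed.

Lemma next_x1 f : next x1 f = false.
Proof. by apply/negP => /next_neq_x1[]; rewrite eqxx. Qed.

Lemma next_uniqr i f f' : next i f -> next i f' -> f = f'.
Proof.
move=> /andP[/eqP pf /existsP[r /andP[ri rf]]].
move=> /andP[/eqP pf' /existsP[r' /andP[ri' rf']]].
rewrite -(in_block_uniq ri ri') in rf'.
by apply: (in_block_pos_inj rf rf'); rewrite pf pf'.
Qed.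

Lemma next_uniql i i' f : next i f -> next i' f -> i = i'.
Proof.
move=> /andP[/eqP pf /existsP[r /andP[ri rf]]].
move=> /andP[/eqP pf' /existsP[r' /andP[ri' rf']]].
rewrite -(in_block_uniq rf rf') in ri'.
by apply: (in_block_pos_inj ri ri'); move: pf; rewrite pf' => -[].
Qed.

Lemma next_wt r i f : next i f -> wt r f = wt r x1 + wt r i.
Proof.
move=> /andP[/eqP pf /existsP[r' /andP[ri rf]]]; rewrite !wtE in_block_x1 pf.
case: ifP => _; first by rewrite -natrD add1n.
rewrite add0r; congr (nat_of_bool _)%:R; apply/idP/idP => rin.
  by rewrite (in_block_uniq rin rf).
by rewrite (in_block_uniq rin ri).
Qed.

Lemma next_xE (a b : 'I_(psum n k).+1) :
  next (inl (inl a)) (inl (inl b)) = (b == a.+1 :> nat) && x_step n a.+1.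
Proof.
rewrite /next /= eqSS; case: eqP => //= bE; apply/existsP/existsP.
  case=> -[r|//] /=; case: unlift => // j; rewrite bE /x_block => rin.
  by exists j; lia.
case=> j jin; exists (inl (lift ord0 j)); rewrite /= liftK bE /x_block; lia.
Qed.

Lemma next_yE (a b : 'I_(psum m p)) :
  next (inr a) (inr b) = (b == a.+1 :> nat) && y_step m a.+1.
Proof.
rewrite /next /= eqSS; case: eqP => //= bE; apply/existsP/existsP.
  case=> -[//|l] /=; rewrite bE /y_block => rin.
  by exists l; lia.
case=> j jin; exists (inr j); rewrite /= bE /y_block; lia.
Qed.

Lemma next_mixed (a : 'I_(psum n k).+1) (b : 'I_(psum m p)) :
  (next (inl (inl a)) (inr b) = false) * (next (inr b) (inl (inl a)) = false).
Proof.
by split; apply/negbTE/negP => /andP[_ /existsP[[r|l] /andP[]]].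
Qed.

Lemma sc_skew i j f : SN_sc j i f = - SN_sc i j f.
Proof.
case: i j f => [e|b] [e'|b'] [f|c] //=; rewrite ?oppr0 ?opprK //.
by rewrite /table00 !ffunE opprB.
Qed.

Lemma sc_tor r i f : SN_sc (tor r) i f = wt r i * (i == f)%:R.
Proof.
case: i f => [[a|s]|b] [[a'|s']|b'] //=; rewrite ?mulr0 ?mul0r //.
- rewrite /table00 /= subr0 !ffunE eqSS eq_sym; congr (_ * _%:R).
- by rewrite /table00 /= subr0 !ffunE scaler0.
- by rewrite /table00 /= subr0 !ffunE.
- by rewrite /table00 /= subr0 !ffunE.
- by rewrite !ffunE eqSS eq_sym.
Qed.

Lemma sc_nil i j f : nil_index i -> nil_index j ->
  SN_sc i j f = ((i == x1) && next j f)%:R - ((j == x1) && next i f)%:R.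
Proof.
have eqx1 (a : 'I_(psum n k).+1) : (inl (inl a) == x1) = (a == 0%N :> nat).
  by apply/eqP/eqP => [[->]//|a0]; congr (inl (inl _)); apply: val_inj.
have stepE (a b : 'I_(psum n k).+1) (f' : even_index p n) :
    ((listed00 K (inl a) (inl b : even_index p n) : {ffun _ -> K^o}) f')
    = ((inl (inl a) == x1) && next (inl (inl b)) (inl f' : I))%:R.
  rewrite /= eqx1; case: f' => [c|s]; last first.
    rewrite (_ : next _ _ = false) ?andbF; last first.
      by apply/negP => /next_nil[].
    by case: ifP; rewrite ffunE.
  rewrite next_xE; case: (_ == _) => /=; last by rewrite ffunE.
  by case: x_step; rewrite ?andbF ?andbT ffunE ?eqSS.
case: i j => [[a|s]|b] [[a'|s']|b'] //= _ _.
- case: f => [f|c]; last by rewrite !next_mixed !andbF subrr.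
  by rewrite /table00 ffunE -!stepE ffunE.
- rewrite /= subr0 eqx1; case: f => [[f|s]|c].
  + by rewrite next_mixed andbF.
  + by rewrite (_ : next _ _ = false) ?andbF //; apply/negP => /next_nil[].
  rewrite next_yE; case: (_ == _) => /=; last by rewrite ffunE.
  by case: y_step; rewrite ?andbF ?andbT ffunE ?eqSS.
- rewrite /= sub0r eqx1; case: f => [[f|s]|c].
  + by rewrite next_mixed andbF oppr0.
  + rewrite (_ : next _ _ = false) ?andbF ?oppr0 //.
  rewrite next_yE; congr (- _); case: (_ == _) => /=; last by rewrite ffunE.
  by case: y_step; rewrite ?andbF ?andbT ffunE ?eqSS.
- by rewrite subrr.
Qed.

Local Arguments in_block : simpl never.
Local Arguments SN_sc : simpl never.
Local Arguments wt : simpl never.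

(** * Weights of the torus *)

Lemma sc_homogeneous i j f :
  SN_sc i j f != 0 -> forall r, wt r f = wt r i + wt r j.
Proof.
have tor_case s j' f' : SN_sc (tor s) j' f' != 0 ->
    forall r, wt r f' = wt r (tor s) + wt r j'.
  rewrite sc_tor; case: (eqVneq j' f') => [-> _ r|_]; first by rewrite add0r.
  by rewrite mulr0 eqxx.
case: (boolP (nil_index i)) => [ni|]; last by case: i => [[a|s]|b] // _ /tor_case.
case: (boolP (nil_index j)) => [nj|]; last first.
  case: j => [[a|s]|b] // _; rewrite -[SN_sc _ _ _]opprK -sc_skew oppr_eq0.
  by move=> /tor_case wtf r; rewrite addrC.
rewrite sc_nil // => sc_n0 r; case/boolP: ((i == x1) && next j f) sc_n0.
  by case/andP=> /eqP-> /next_wt->.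
case/boolP: ((j == x1) && next i f) => [|_ _]; last by rewrite subrr eqxx.
by case/andP=> /eqP-> /next_wt-> _ _; rewrite addrC.
Qed.

Lemma sum_sc_tor (c : I -> K) r i : \sum_l SN_sc (tor r) i l * c l = wt r i * c i.
Proof.
rewrite (bigD1 i) //= sc_tor eqxx mulr1 big1 ?addr0 // => l /negbTE ne.
by rewrite sc_tor eq_sym ne mulr0 mul0r.
Qed.

Lemma sum_sc_tor_mid (c : I -> K) r f :
  \sum_l SN_sc (tor r) l f * c l = wt r f * c f.
Proof.
rewrite (bigD1 f) //= sc_tor eqxx mulr1 big1 ?addr0 // => l /negbTE ne.
by rewrite sc_tor ne mulr0 mul0r.
Qed.

Lemma cobound1_tor (b : I -> I -> K) r j f :
  cobound1 odd_index SN_sc b (tor r) j f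
  = (wt r j - wt r f) * b j f + \sum_l SN_sc j l f * b (tor r) l.
Proof. by rewrite /cobound1 sum_sc_tor sum_sc_tor_mid expr0 mul1r mulrBl. Qed.

Lemma sum_sc_nil (c : I -> K) i f : nil_index i -> i != f ->
  \sum_l SN_sc i l f * c l
  = (i == x1)%:R * (\sum_(l | next l f) c l) - (next i f)%:R * c x1.
Proof.
move=> ni ne.
have -> : \sum_l SN_sc i l f * c l = \sum_l ((i == x1)%:R * (next l f)%:R * c l
    - (l == x1)%:R * (next i f)%:R * c l).
  apply: eq_bigr => l _; case: (boolP (nil_index l)) => [nl|].
    by rewrite sc_nil // -!mulnb !natrM mulrBl.
  case: l => [[a|s]|b] // _; rewrite sc_skew sc_tor.
  rewrite eq_sym in ne; rewrite [_ == f]eq_sym (negbTE ne) mulr0 oppr0 mul0r.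
  rewrite (_ : next _ _ = false) /= ?mulr0 ?mul0r ?subr0 //.
  by apply/negP => /next_nil[].
rewrite big_split /= sumrN; congr (_ - _).
  rewrite mulr_sumr [RHS]big_mkcond; apply: eq_bigr => l _.
  by case: next; rewrite ?mulr1 ?mulr0 ?mul0r.
rewrite (bigD1 x1) //= mul1r big1 ?addr0 // => l /negbTE->.
by rewrite !mul0r.
Qed.

Lemma sum_nextl (c : I -> K) i f : next i f -> \sum_(l | next l f) c l = c i.
Proof.
move=> nif; rewrite (bigD1 i) //= big1 ?addr0 // => l /andP[nlf /negP[]].
by apply/eqP/(next_uniql nlf nif).
Qed.

(** The entries of b off the diagonal drop out: i moves to f only, f is reached
    from i only, and no step starts or ends at x_1. *)
Lemma cobound1_next (b : I -> I -> K) i f : next i f ->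
  cobound1 odd_index SN_sc b x1 i f = b f f - b i i - b x1 x1.
Proof.
move=> nif; have [ni nf] := next_nil nif; have [ix fx] := next_neq_x1 nif.
have if_ne : i != f.
  by apply/eqP => ef; case/andP: nif => /eqP; rewrite ef; lia.
rewrite /cobound1 !sum_sc_nil //; last by rewrite eq_sym fx.
rewrite eqxx mul1r next_x1 mul0r subr0 (sum_nextl _ nif) ix nif expr0 !mul1r mul0r.
rewrite sub0r; congr (_ - _ - _); rewrite (bigD1 f) //= big1 => [|l /negbTE lf].
  by rewrite sc_nil // eqxx nif ix /= subr0 mul1r addr0.
case: (boolP (nil_index l)) => [nl|nl].
  rewrite sc_nil // eqxx ix /= subr0.
  case: (boolP (next i l)) => [nil|]; rewrite ?mul0r //.
  by rewrite (next_uniqr nil nif) eqxx in lf.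
rewrite sc_nil // eqxx ix /= subr0 (_ : next i l = false) ?mul0r //.
by apply/negP => /next_nil[_ nl']; rewrite nl' in nl.
Qed.

Hypothesis charK0 : [pchar K] =i pred0.

Lemma natr_inj : injective (fun c : nat => c%:R : K).
Proof.
have nat0 : forall c, (c%:R == 0 :> K) = (c == 0)%N by apply/pcharf0P.
have le_inj a b : (a <= b)%N -> a%:R = b%:R :> K -> a = b.
  move=> le_ab /esym/eqP; rewrite -subr_eq0 -natrB // nat0 subn_eq0 => le_ba.
  by apply/eqP; rewrite eqn_leq le_ab.
move=> a b ab; case: (leqP a b) => [le_ab|/ltnW le_ba]; first exact: le_inj.
exact/esym/le_inj.
Qed.

Lemma wt_eq0 i : (forall r, wt r i = 0) -> ~~ nil_index i.
Proof.
by move=> /(_ t1); rewrite wtE eqxx -[0]/(0%:R) => /natr_inj; case: i => [[]|].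
Qed.

Lemma nil_index_pos i : nil_index i = (0 < pos i)%N.
Proof. by case: i => [[]|]. Qed.

Lemma wt_block r i : in_block r i -> wt r i = 1.
Proof.
move=> ri; rewrite wtE ri; case: eqP => // rt; move: ri.
by rewrite rt in_block_t1.
Qed.

Lemma in_block_wt r i f : in_block r i -> wt r f = 1 -> in_block r f.
Proof.
move=> ri; rewrite wtE; case: eqP => [rt|_]; first by rewrite rt in_block_t1 in ri.
by case: in_block => // /(@natr_inj 0%N 1%N).
Qed.

Lemma wt_pos i j : wt t1 i = wt t1 j -> pos i = pos j.
Proof. by rewrite !wtE eqxx => /natr_inj. Qed.

(** The t_1-weight is the position in the whole numbering of the x or of the y,
    and a block separates the x from the y. *)
Lemma wt_inj i f : nil_index i -> (forall r, wt r f = wt r i) -> f = i.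
Proof.
move=> ni wtf; have posE := wt_pos (wtf t1).
have nf : nil_index f by rewrite nil_index_pos posE -nil_index_pos.
case: (eqVneq i x1) => [i1|ix].
  case: (eqVneq f x1) => [->//|fx]; have [r rf] := in_block_ex nf fx.
  have := in_block_wt rf (etrans (esym (wtf r)) (wt_block rf)).
  by rewrite i1 in_block_x1.
have [r ri] := in_block_ex ni ix.
have rf := in_block_wt ri (etrans (wtf r) (wt_block ri)).
exact: in_block_pos_inj rf ri posE.
Qed.

Lemma wt_x1_add i f : nil_index i ->
  (forall r, wt r f = wt r x1 + wt r i) -> next i f.
Proof.
move=> ni wtf; have posE : pos f = (pos i).+1.
  by have := wtf t1; rewrite !wtE eqxx -natrD => /natr_inj.
have nf : nil_index f by rewrite nil_index_pos posE.
have wt_x1 r : r != t1 -> wt r x1 = 0 by rewrite wtE in_block_x1; case: ifP.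
have fx : f != x1.
  by apply/eqP => f1; move: posE ni; rewrite f1 nil_index_pos /=; lia.
have [r rf] := in_block_ex nf fx.
have rt : r != t1 by apply/eqP => rt; rewrite rt in_block_t1 in rf.
rewrite /next posE eqxx; apply/existsP; exists r; rewrite rf andbT.
by apply: (in_block_wt rf); rewrite -(wt_block rf) wtf wt_x1 // add0r.
Qed.

(** Off x_1, each summand has weight 1 on its own block.  If neither summand is
    x_1, then f has weight 1 there too: f lies in both blocks, which coincide,
    and the sum has weight 2 on it, which is no weight in characteristic 0. *)
Lemma wt_add i j f : nil_index i -> nil_index j ->
  (forall r, wt r f = wt r i + wt r j) ->
  ((i == x1) && next j f) || ((j == x1) && next i f).
Proof.
move=> ni nj wtf.
case: (eqVneq i x1) => [i1|ix]; first by rewrite wt_x1_add // => r; rewrite wtf i1.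
case: (eqVneq j x1) => [j1|jx].
  by rewrite /= wt_x1_add // => r; rewrite wtf j1 addrC.
have key u v r : in_block r u -> wt r f = wt r u + wt r v ->
    in_block r f && ~~ in_block r v.
  move=> ru; have rt : (r == t1) = false.
    by apply/eqP => rt; rewrite rt in_block_t1 in ru.
  by rewrite !wtE rt ru -natrD => /natr_inj; case: in_block; case: in_block.
have [r ri] := in_block_ex ni ix; have [r' rj] := in_block_ex nj jx.
have /andP[rf /negP[]] := key _ _ _ ri (wtf r).
have /andP[rf' _] := key _ _ _ rj (etrans (wtf r') (addrC _ _)).
by rewrite (in_block_uniq rf rf').
Qed.

Hypotheses (hn : forall j, (1 <= n j)%N) (hm : forall j, (1 <= m j)%N).

Lemma sum_wt (theta : R -> K) i : \sum_r theta r * wt r i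
  = theta t1 * (pos i)%:R + \sum_(r | in_block r i) theta r.
Proof.
rewrite (bigD1 t1) //= wtE eqxx; congr (_ + _).
rewrite [RHS]big_mkcond [in RHS](bigD1 t1) //= in_block_t1 add0r.
apply: eq_bigr => r /negbTE rt; rewrite wtE rt.
by case: in_block; rewrite ?mulr1 ?mulr0.
Qed.

Lemma sum_wt_block (theta : R -> K) r i : in_block r i ->
  \sum_r theta r * wt r i = theta t1 * (pos i)%:R + theta r.
Proof.
move=> ri; rewrite sum_wt (bigD1 r) //= big1 ?addr0 // => s /andP[si /eqP[]].
exact: in_block_uniq si ri.
Qed.

Lemma sum_wt_x1 (theta : R -> K) : \sum_r theta r * wt r x1 = theta t1.
Proof. by rewrite sum_wt mulr1 big_pred0 ?addr0 // => r; apply: in_block_x1. Qed.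

(** The weights of x_1 and of the first vector of each block form a triangular
    system with unit diagonal: one equation per element of the torus basis. *)
Lemma torus_faithful (theta : R -> K) :
  (forall i, nil_index i -> \sum_r theta r * wt r i = 0) -> forall r, theta r = 0.
Proof.
move=> theta0; have theta_t1 : theta t1 = 0 by rewrite -sum_wt_x1 theta0.
move=> r; case: (eqVneq r t1) => [->//|/(in_block_start hn hm)[i ri]].
have := sum_wt_block theta ri; rewrite theta0 ?theta_t1 ?mul0r ?add0r //.
by case: i r ri => [[a|s]|b] [].
Qed.

(** Subtracting the multiple of t_1 that has the right value at x_1 leaves a
    function constant on each block, a combination of block indicators. *)
Lemma additive_is_torus (a : I -> K) :
    (forall i f, next i f -> a f = a i + a x1) ->
  exists theta : R -> K, forall i, nil_index i -> \sum_r theta r * wt r i = a i.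
Proof.
move=> aS; pose h i := a i - a x1 * (pos i)%:R.
have hS i f : next i f -> h f = h i.
  move=> nif; rewrite /h (aS _ _ nif); case/andP: nif => /eqP-> _.
  by rewrite -natr1; ring.
have [theta thetaE] : exists theta : R -> K, forall r,
    forall i, in_block r i -> theta r = h i.
  apply: (fin_all_exists (P := fun r t => forall i, in_block r i -> t = h i)) => r.
  case: (eqVneq r t1) => [->|/(in_block_start hn hm)[i ri]].
    by exists 0 => i; rewrite in_block_t1.
  by exists (h i) => f; apply: in_block_const hS _ _ _ ri.
pose theta' r := if r == t1 then a x1 else theta r.
exists theta' => i ni; case: (eqVneq i x1) => [->|/(in_block_ex ni)[r ri]].
  by rewrite sum_wt_x1 /theta' eqxx.
rewrite (sum_wt_block _ ri) {1}/theta' eqxx /theta' ifN ?(thetaE _ _ ri) /h.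
  by ring.
by apply/eqP => rt; rewrite rt in_block_t1 in ri.
Qed.

(** * Vanishing in coordinates *)

Lemma sum_torus (c : I -> K) : (forall l, nil_index l -> c l = 0) ->
  \sum_l c l = \sum_r c (tor r).
Proof.
move=> c0; rewrite !big_sumType /= [X in X + _ + _]big1 => [|a _]; last exact: c0.
by rewrite add0r [X in _ + X]big1 ?addr0 // => b _; apply: c0.
Qed.

Lemma sum_sc_torus (c : I -> K) i f : (forall l, nil_index l -> c l = 0) ->
  \sum_l SN_sc i l f * c l = - ((i == f)%:R * \sum_r c (tor r) * wt r i).
Proof.
move=> c0; rewrite sum_torus => [|l /c0->]; last by rewrite mulr0.
rewrite mulr_sumr -sumrN; apply: eq_bigr => r _.
by rewrite sc_skew sc_tor mulNr -mulrA mulrCA [wt r i * _]mulrC.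
Qed.

Lemma sum_sc_diag (c : I -> K) i : nil_index i ->
  \sum_l SN_sc i l i * c l = - \sum_r c (tor r) * wt r i.
Proof.
move=> ni; rewrite sum_torus => [|l nl].
  rewrite -sumrN; apply: eq_bigr => r _.
  by rewrite sc_skew sc_tor eqxx mulr1 mulNr mulrC.
have [->|/sc_homogeneous wti] := eqVneq (SN_sc i l i) 0; first by rewrite mul0r.
suff /negP[] : ~~ nil_index l by [].
by apply: wt_eq0 => r; apply: (addrI (wt r i)); rewrite -wti addr0.
Qed.

Lemma torN_nil i : ~~ nil_index i -> exists r, i = tor r.
Proof. by case: i => [[a|r]|b] // _; exists r. Qed.

(** A vector killed by T has weight zero, hence lies in T; an element of T that
    kills N is zero. *)
Lemma coef_vanishing0 (v : I -> K) :
  (forall i f, cobound0 SN_sc v i f = 0) -> forall f, v f = 0.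
Proof.
move=> v0.
have v_nil f : nil_index f -> v f = 0.
  move=> nf; have [//|vf] := eqVneq (v f) 0.
  have /wt_eq0 : forall r, wt r f = 0; last by rewrite nf.
  move=> r; have /eqP := v0 (tor r) f; rewrite oppr_eq0 sum_sc_tor_mid.
  by rewrite mulf_eq0 (negbTE vf) orbF => /eqP.
move=> f; case: (boolP (nil_index f)) => [/v_nil//|/torN_nil[r ->]].
apply: (torus_faithful (theta := fun r => v (tor r))) => i ni.
have /eqP := v0 i i; rewrite /cobound0 (sum_sc_torus _ _ v_nil) opprK eqxx mul1r.
by move/eqP.
Qed.

(** The part of nonzero weight is inner by contraction.  What remains is diagonal
    on N and additive along steps, so it is the action of an element of T. *)
Lemma coef_vanishing1 (D : I -> I -> K) :
    (forall i j f, ~~ odd_index i -> cobound1 odd_index SN_sc D i j f = 0) ->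
  exists v : I -> K, forall i f, D i f = cobound0 SN_sc v i f.
Proof.
move=> D0.
have DT r s : D (tor r) (tor s) = 0.
  apply: (torus_faithful (theta := fun s => D (tor r) (tor s))) => i ni.
  have := D0 (tor r) i i isT; rewrite cobound1_tor subrr mul0r add0r.
  by rewrite sum_sc_diag // => /eqP; rewrite oppr_eq0 => /eqP.
have [theta thetaE] : exists theta : R -> K,
    forall i, nil_index i -> \sum_r theta r * wt r i = D i i.
  apply: additive_is_torus => i f nif.
  have := D0 x1 i f isT; rewrite cobound1_next // => /eqP.
  by rewrite subr_eq0 subr_eq => /eqP->; rewrite addrC.
pose vc l := contract (defect0 wt l) (fun r => D (tor r) l).
pose vt (l : I) := if l is inl (inr r) then theta r else 0.
exists (fun l => vc l + vt l) => i f.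
have -> : cobound0 SN_sc (fun l => vc l + vt l) i f
    = cobound0 SN_sc vc i f + cobound0 SN_sc vt i f.
  rewrite /cobound0 -opprD -big_split; congr (- _).
  by apply: eq_bigr => l _; rewrite mulrDr.
rewrite /vc (cobound0_contract sc_homogeneous); last first.
  move=> r; have := D0 (tor r) i f isT; rewrite cobound1_tor ffunE /cobound0.
  by move/eqP; rewrite addr_eq0 => /eqP => DE; rewrite opprK -[RHS]opprK -DE; ring.
rewrite /cobound0 (@sum_sc_torus vt); last by case=> [[]|].
rewrite opprK; case: eqP => [/ffunP def0|def0]; last first.
  have [if_eq|_] := eqVneq i f; last by rewrite mul0r addr0.
  by case: def0; apply/ffunP => r; rewrite !ffunE if_eq subrr.
have wtif r : wt r f = wt r i.
  by apply/eqP; rewrite -subr_eq0; have := def0 r; rewrite !ffunE => ->.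
case: (boolP (nil_index i)) => [ni|ni].
  by rewrite (wt_inj ni wtif) eqxx mul1r add0r thetaE.
have [r ->] := torN_nil ni; have /torN_nil[s ->] : ~~ nil_index f.
  by apply: wt_eq0 => s; rewrite wtif; case: i ni {def0 wtif} => [[]|].
by rewrite DT big1 ?mulr0 ?addr0 // => s' _; rewrite mulr0.
Qed.

(** The order in which a cochain takes its arguments: even ones before odd ones. *)
Definition ordered (i j : I) := odd_index i ==> odd_index j.

Lemma cobound1_skew (b : I -> I -> K) i j f : ~~ (odd_index i && odd_index j) ->
  cobound1 odd_index SN_sc b j i f = - cobound1 odd_index SN_sc b i j f.
Proof.
move=> /negbTE ij; rewrite /cobound1 andbC ij expr0 !mul1r.
have -> : \sum_l SN_sc j i l * b l f = - \sum_l SN_sc i j l * b l f.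
  by rewrite -sumrN; apply: eq_bigr => l _; rewrite sc_skew mulNr.
by ring.
Qed.

Lemma cobound1_eq0 (b : I -> I -> K) i j f :
    (forall l h, b l h != 0 -> forall r, wt r l = wt r h) ->
  defect2 wt i j f != 0 -> cobound1 odd_index SN_sc b i j f = 0.
Proof.
move=> b0 /eqP def_n0.
have term0 a l h : (a != 0 -> (forall r, wt r l = wt r h) ->
    forall r, wt r f = wt r i + wt r j) -> a * b l h = 0.
  move=> ah; have [->|a_n0] := eqVneq a 0; first by rewrite mul0r.
  have [->|/b0 blh] := eqVneq (b l h) 0; first by rewrite mulr0.
  case: def_n0; apply/ffunP => r; rewrite !ffunE (ah a_n0 blh); ring.
rewrite /cobound1 !big1 ?mulr0 ?subr0 ?addr0 // => l _; apply: term0.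
- by move=> /sc_homogeneous wtf wtb r; rewrite wtf wtb addrC.
- by move=> /sc_homogeneous wtf wtb r; rewrite wtf wtb.
- by move=> /sc_homogeneous wtf wtb r; rewrite -wtb wtf.
Qed.

(** The second hypothesis is the Cartan formula, that is, the cocycle identity at
    the triples that start with a torus element. *)
Lemma coef_vanishing2 (C : I -> I -> I -> K) :
    (forall i j f, ~~ odd_index i -> ~~ odd_index j -> C i j f = - C j i f) ->
    (forall r i j f, ordered i j ->
      defect2 wt i j f r * C i j f
      = - cobound1 odd_index SN_sc (C (tor r)) i j f) ->
  exists b : I -> I -> K, forall i j f, ordered i j ->
    C i j f = cobound1 odd_index SN_sc b i j f.
Proof.
move=> Cskew cart.
have cart0 r i j f : ordered i j -> (forall r, wt r f = wt r i + wt r j) ->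
    cobound1 odd_index SN_sc (C (tor r)) i j f = 0.
  move=> oij wtf; have := cart r i j f oij; rewrite ffunE wtf.
  rewrite (_ : _ - _ = 0); last by ring.
  by rewrite mul0r => /esym/eqP; rewrite oppr_eq0 => /eqP.
have CT r s q : C (tor r) (tor s) (tor q) = 0.
  apply: (torus_faithful (theta := fun q => C (tor r) (tor s) (tor q))) => i ni.
  have := cart0 r (tor s) i i isT; rewrite cobound1_tor subrr mul0r add0r.
  rewrite sum_sc_diag // => C0; apply: oppr_inj; rewrite oppr0 C0 // => r'.
  by rewrite add0r.
have [theta thetaE] : exists theta : R -> R -> K, forall r,
    forall i, nil_index i -> \sum_s theta r s * wt s i = - C (tor r) i i.
  apply: (fin_all_exists (P := fun r th => forall i, nil_index i ->
    \sum_s th s * wt s i = - C (tor r) i i)) => r.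
  apply: additive_is_torus => i f nif.
  have := cart0 r x1 i f isT (fun s => next_wt s nif); rewrite cobound1_next //.
  move/eqP; rewrite subr_eq0 subr_eq => /eqP->; ring.
(* The coboundary of bc is the part of nonzero weight, that of bt the part of
   weight zero; theta is the restriction of bt to T, and g its diagonal on N. *)
have [g [g1 gS]] := next_potential (fun i f => C x1 i f).
pose bc l h := contract (defect1 wt l h) (fun r => C (tor r) l h).
pose bt (l h : I) := match l with
  | inl (inr r) => if h is inl (inr s) then theta r s else 0
  | _ => g l * (l == h)%:R
  end.
have bt_nil l h : nil_index l -> bt l h = g l * (l == h)%:R by case: l => [[]|].
have bt0 l h : bt l h != 0 -> forall r, wt r l = wt r h.
  case: (boolP (nil_index l)) => [nl|/torN_nil[s ->]].
    by rewrite bt_nil //; case: (l =P h) => [-> //|_]; rewrite mulr0 eqxx.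
  by case: h => [[a|q]|c] //=; rewrite eqxx.
have btT r j f : cobound1 odd_index SN_sc bt (tor r) j f
    = - ((j == f)%:R * \sum_s theta r s * wt s j).
  rewrite cobound1_tor sum_sc_torus; last by case=> [[]|].
  have [->|/bt0->] := eqVneq (bt j f) 0; first by rewrite mulr0 add0r.
  by rewrite subrr mul0r add0r.
exists (fun l h => bc l h + bt l h) => i j f oij.
have -> : cobound1 odd_index SN_sc (fun l h => bc l h + bt l h) i j f
    = cobound1 odd_index SN_sc bc i j f + cobound1 odd_index SN_sc bt i j f.
  have sumD (c d d' : I -> K) :
      \sum_l c l * (d l + d' l) = \sum_l c l * d l + \sum_l c l * d' l.
    by rewrite -big_split; apply: eq_bigr => l _; rewrite mulrDr.
  by rewrite /cobound1 !sumD; ring.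
rewrite /bc (cobound1_contract sc_homogeneous); last by move=> r; apply: cart.
case: ifPn => [/eqP/ffunP def0|def_n0]; last by rewrite cobound1_eq0 // addr0.
have {def0} wtf r : wt r f = wt r i + wt r j.
  have := def0 r; rewrite !ffunE => /eqP; rewrite subr_eq0 subr_eq => /eqP->.
  by rewrite addrC.
rewrite add0r.
have torE r j' : (forall s, wt s f = wt s j') ->
    C (tor r) j' f = cobound1 odd_index SN_sc bt (tor r) j' f.
  move=> wtf'; rewrite btT; case: (boolP (nil_index j')) => [nj|nj].
    by rewrite (wt_inj nj wtf') eqxx mul1r thetaE // opprK.
  have [s ->] := torN_nil nj; have /torN_nil[q ->] : ~~ nil_index f.
    by apply: wt_eq0 => s'; rewrite wtf'; case: j' nj {wtf'} => [[]|].
  by rewrite CT big1 ?mulr0 ?oppr0 // => s' _; rewrite mulr0.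
have nextE j' : next j' f -> C x1 j' f = cobound1 odd_index SN_sc bt x1 j' f.
  move=> njf; have [nj nf] := next_nil njf.
  rewrite cobound1_next // !bt_nil // !eqxx !mulr1 g1 (gS _ _ njf); ring.
case: (boolP (nil_index i)) => [ni|/torN_nil[r iE]]; last first.
  by rewrite iE torE // => s; rewrite wtf iE add0r.
case: (boolP (nil_index j)) => [nj|/torN_nil[r jE]]; last first.
  have ei : ~~ odd_index i by move: oij; rewrite /ordered jE implybF.
  rewrite jE Cskew // cobound1_skew ?andbF // torE // => s.
  by rewrite wtf jE addr0.
case/orP: (wt_add ni nj wtf) => /andP[/eqP xE]; first by rewrite xE => /nextE.
have ei : ~~ odd_index i by move: oij; rewrite /ordered xE implybF.
by move=> /nextE jf; rewrite xE Cskew // cobound1_skew ?andbF // jf.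
Qed.

End SNConstants.

(** * Differentials in low degree *)

Section LowDegree.

Variables (K : fieldType) (g : lieSuperalgebra K) (A : supermodule g).
Local Notation g0 := (even_part g).
Local Notation g1 := (odd_part g).
Implicit Types (x y t : g0) (h : g1) (c : seq g0 -> seq g1 -> carrier A).

Lemma size_del (T : Type) i (s : seq T) :
  (i < size s)%N -> size (del i s) = (size s).-1.
Proof.
move=> lti; rewrite size_cat size_drop size_takel; first by lia.
exact: ltnW.
Qed.

Lemma size_del2 (T : Type) i j (s : seq T) :
  (i < j < size s)%N -> size (del i (del j s)) = (size s).-2.
Proof. by move=> /andP[ij js]; rewrite !size_del //; lia. Qed.

Lemma differential_support q c gs hs :
  cochain q c -> (size gs + size hs)%N != q.+1 -> differential c gs hs = 0.
Proof.
move=> cc ne; rewrite /differential.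
rewrite !big1 ?addr0 ?scaler0 ?addr0 // => s _.
- rewrite (cochain_support cc) ?(lin0 (act1_linearr _)) //.
  by have := ltn_ord s; rewrite size_del //; lia.
- rewrite (cochain_support cc) ?(lin0 (act0_linearr _)) ?scaler0 //.
  by have := ltn_ord s; rewrite size_del //; lia.
- rewrite big1 // => -[t lt_t] /= st; rewrite (cochain_support cc) //=.
  by rewrite size_del2 ?st //; move: (nat_of_ord s) st; lia.
- rewrite big1 // => -[t lt_t] _; rewrite (cochain_support cc) ?scaler0 //=.
  by have := ltn_ord s; rewrite !size_del //; move: (nat_of_ord s); lia.
rewrite big1 // => -[t lt_t] /= st; rewrite (cochain_support cc) ?scaler0 //=.
by rewrite size_del2 ?st //; move: (nat_of_ord s) st; lia.
Qed.

Lemma sum_ord_cond_recl (V : nmodType) (q : nat) (P : pred 'I_q.+1)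
    (F : 'I_q.+1 -> V) :
  \sum_(i | P i) F i = (if P ord0 then F ord0 else 0)
    + \sum_(i < q | P (lift ord0 i)) F (lift ord0 i).
Proof. by rewrite big_mkcond big_ord_recl -big_mkcond. Qed.

Ltac expand_differential :=
  rewrite /differential /= !(sum_ord_cond_recl, big_ord0) /= /bump /del /=
          ?(exprS, expr0, mulr1, mulN1r, opprK, scale1r, scaleN1r, scaler0)
          ?(addr0, add0r).

Lemma differential0_even c x : differential c [:: x] [::] = - act0 x (c [::] [::]).
Proof. by expand_differential; rewrite ?opprD ?addrA ?subr0. Qed.
Lemma differential0_odd c h : differential c [::] [:: h] = - act1 h (c [::] [::]).
Proof. by expand_differential; rewrite ?opprD ?addrA ?subr0. Qed.

(** The differential of a cochain of degree 1 with components F0 and F1.  These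
    are kept apart from [differential] because the Cartan formulas below apply
    them to the contraction of a cochain of degree 2. *)
Definition d00 (F0 : g0 -> carrier A) x y : carrier A :=
  F0 (br00 x y) - act0 x (F0 y) + act0 y (F0 x).
Definition d01 (F0 : g0 -> carrier A) (F1 : g1 -> carrier A) x h : carrier A :=
  F1 (br01 x h) - act0 x (F1 h) + act1 h (F0 x).
Definition d11 (F0 : g0 -> carrier A) (F1 : g1 -> carrier A) h h' : carrier A :=
  F0 (br11 h h') - act1 h (F1 h') - act1 h' (F1 h).

Lemma differential1_00 c x y :
  differential c [:: x; y] [::] = d00 (fun u => c [:: u] [::]) x y.
Proof. by rewrite /d00; expand_differential; rewrite addrA subr0. Qed.

Lemma differential1_01 c x h : differential c [:: x] [:: h]
  = d01 (fun u => c [:: u] [::]) (fun u => c [::] [:: u]) x h.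
Proof. by rewrite /d01; expand_differential; rewrite ?addrA. Qed.

Lemma differential1_11 c h h' : differential c [::] [:: h; h']
  = d11 (fun u => c [:: u] [::]) (fun u => c [::] [:: u]) h h'.
Proof. by rewrite /d11; expand_differential; rewrite opprD addrA. Qed.

Lemma differential2_000 c t x y : differential c [:: t; x; y] [::] =
  c [:: br00 t x; y] [::] - c [:: br00 t y; x] [::] + c [:: br00 x y; t] [::]
  - act0 t (c [:: x; y] [::]) + act0 x (c [:: t; y] [::])
  - act0 y (c [:: t; x] [::]).
Proof. by expand_differential; rewrite ?opprD ?addrA ?subr0. Qed.

Lemma differential2_001 c t x h : differential c [:: t; x] [:: h] =
  c [:: br00 t x] [:: h] + c [:: x] [:: br01 t h] - c [:: t] [:: br01 x h]
  - act0 t (c [:: x] [:: h]) + act0 x (c [:: t] [:: h]) - act1 h (c [:: t; x] [::]).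
Proof. by expand_differential; rewrite ?opprD ?addrA ?subr0. Qed.

Lemma differential2_011 c t h h' : differential c [:: t] [:: h; h'] =
  c [::] [:: br01 t h; h'] + c [::] [:: br01 t h'; h] + c [:: br11 h h'; t] [::]
  - act0 t (c [::] [:: h; h']) + act1 h (c [:: t] [:: h'])
  + act1 h' (c [:: t] [:: h]).
Proof. by expand_differential; rewrite ?opprD ?addrA ?subr0. Qed.

Lemma cochain2_swap c x y hs : cochain 2 c -> c [:: x; y] hs = - c [:: y; x] hs.
Proof.
move=> cc; have alt u : c [:: u; u] hs = 0.
  exact: (cochain_alternating cc [::] [::] [::]).
have Dl u v w : c [:: u + v; w] hs = c [:: u; w] hs + c [:: v; w] hs.
  exact: (linD (cochain_linear0 cc [::] [:: w] hs)).
have Dr u v w : c [:: w; u + v] hs = c [:: w; u] hs + c [:: w; v] hs.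
  exact: (linD (cochain_linear0 cc [:: w] [::] hs)).
have /eqP := alt (x + y); rewrite Dl !Dr !alt add0r addr0.
by rewrite addr_eq0 => /eqP.
Qed.

Section OneCochainDifferential.

Variables (F0 : g0 -> carrier A) (F1 : g1 -> carrier A).

Hypotheses (F0_lin : linear F0) (F1_lin : linear F1).

Lemma d00_linearl y : linear ((d00 F0)^~ y).
Proof.
apply: linear_comb; last exact: linear_comp (act0_linearr y) F0_lin.
apply: linear_comb; first exact: linear_comp F0_lin (br00_linearl y).
by move=> a u v; rewrite (act0_linearl (F0 y)) opprD scalerN.
Qed.

Lemma d00_linearr x : linear (d00 F0 x).
Proof.
apply: linear_comb; last exact: (act0_linearl (F0 x)).
apply: linear_comb; first exact: linear_comp F0_lin (br00_linearr x).
by move=> a u v; rewrite F0_lin (act0_linearr x) opprD scalerN.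
Qed.

Lemma d01_linearl h : linear ((d01 F0 F1)^~ h).
Proof.
apply: linear_comb; last exact: linear_comp (act1_linearr h) F0_lin.
apply: linear_comb; first exact: linear_comp F1_lin (br01_linearl h).
by move=> a u v; rewrite (act0_linearl (F1 h)) opprD scalerN.
Qed.

Lemma d01_linearr x : linear (d01 F0 F1 x).
Proof.
apply: linear_comb; last exact: (act1_linearl (F0 x)).
apply: linear_comb; first exact: linear_comp F1_lin (br01_linearr x).
by move=> a u v; rewrite F1_lin (act0_linearr x) opprD scalerN.
Qed.

Lemma d11_linearr h : linear (d11 F0 F1 h).
Proof.
apply: linear_comb.
  apply: linear_comb; first exact: linear_comp F0_lin (br11_linearr h).
  by move=> a u v; rewrite F1_lin (act1_linearr h) opprD scalerN.
by move=> a u v; rewrite (act1_linearl (F1 h)) opprD scalerN.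
Qed.

Lemma d11_linearl h : linear ((d11 F0 F1)^~ h).
Proof.
have sym u : d11 F0 F1 u h = d11 F0 F1 h u by rewrite /d11 (br11_sym h) addrAC.
by move=> a u v; rewrite !sym d11_linearr.
Qed.

End OneCochainDifferential.

Section Cartan.

Variables (c : seq g0 -> seq g1 -> carrier A) (t : g0).
Hypothesis cc : cochain 2 c.
Let F0 u := c [:: t; u] [::].
Let F1 u := c [:: t] [:: u].

(** The Cartan formula i_t d + d i_t = - L_t, evaluated at eigenvectors of t; here
    i_t is the contraction by t and L_t the action of t on cochains. *)
Lemma cartan00 x y (a b : K) : br00 t x = a *: x -> br00 t y = b *: y ->
  differential c [:: t; x; y] [::] =
  (a + b) *: c [:: x; y] [::] - act0 t (c [:: x; y] [::]) - d00 F0 x y.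
Proof.
move=> tx ty; rewrite differential2_000 tx ty /d00 /F0.
rewrite (linZ (cochain_linear0 cc [::] [:: y] [::])).
rewrite (linZ (cochain_linear0 cc [::] [:: x] [::])).
rewrite (cochain2_swap y x) // (cochain2_swap _ t) // scalerN opprK scalerDl.
by rewrite !opprD !opprK !addrA [_ + _ - act0 t _]addrAC.
Qed.

Lemma cartan01 x h (a b : K) : br00 t x = a *: x -> br01 t h = b *: h ->
  differential c [:: t; x] [:: h] =
  (a + b) *: c [:: x] [:: h] - act0 t (c [:: x] [:: h]) - d01 F0 F1 x h.
Proof.
move=> tx th; rewrite differential2_001 tx th /d01 /F0 /F1.
rewrite (linZ (cochain_linear0 cc [::] [::] [:: h])).
rewrite (linZ (cochain_linear1 cc [:: x] [::] [::])) scalerDl.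
by rewrite !opprD !opprK !addrA [_ - act0 t _]addrAC.
Qed.

Lemma cartan11 h h' (a b : K) : br01 t h = a *: h -> br01 t h' = b *: h' ->
  differential c [:: t] [:: h; h'] =
  (a + b) *: c [::] [:: h; h'] - act0 t (c [::] [:: h; h']) - d11 F0 F1 h h'.
Proof.
move=> th th'; rewrite differential2_011 th th' /d11 /F0 /F1.
rewrite (linZ (cochain_linear1 cc [::] [::] [:: h'])).
rewrite (linZ (cochain_linear1 cc [::] [::] [:: h])).
have -> : c [::] [:: h'; h] = c [::] [:: h; h'].
  by apply: (cochain_symmetric cc); rewrite (perm_catC [:: _] [:: _]).
rewrite (cochain2_swap _ t) // scalerDl.
by rewrite !opprD !opprK !addrA [_ - act0 t _]addrAC.
Qed.

End Cartan.

End LowDegree.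

(** * Coordinates of cochains on SN *)

Section Coordinates.

Variables (K : fieldType) (k p : nat) (n : 'I_k -> nat) (m : 'I_p -> nat).

Local Notation L := (SN K n m).
Local Notation V := (carrier (adjoint L)).
Local Notation I := (SN_index n m).
Local Notation g0 := (SN_even K p n).
Local Notation g1 := (SN_odd K m).
Local Notation e0 e := (ffun_basis K e : even_part L).
Local Notation e1 b := (ffun_basis K b : odd_part L).
Local Notation act0 := (@act0 K L (adjoint L)).
Local Notation act1 := (@act1 K L (adjoint L)).
Local Notation sc := (@SN_sc K k p n m).

Definition coef (f : I) (v : V) : K :=
  match f with inl e => (v.1 : {ffun _ -> K^o}) e
             | inr b => (v.2 : {ffun _ -> K^o}) b end.

Definition of_coef (c : I -> K) : V :=
  ([ffun e => c (inl e)] : g0, [ffun b => c (inr b)] : g1).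

Lemma of_coefK c f : coef f (of_coef c) = c f.
Proof. by case: f => [e|b]; rewrite /= ffunE. Qed.

Lemma coef_inj (v w : V) : (forall f, coef f v = coef f w) -> v = w.
Proof.
move=> vw; apply: pair_ext; apply/ffunP => e; first exact: (vw (inl e)).
exact: (vw (inr e)).
Qed.

Lemma coef_linear f : linear (coef f : V -> K^o).
Proof. by case: f => [e|b] a v w; rewrite /= !ffunE. Qed.

Lemma coefD f v w : coef f (v + w) = coef f v + coef f w.
Proof. exact: linD (coef_linear f) _ _. Qed.

Lemma coefN f v : coef f (- v) = - coef f v.
Proof. exact: linN (coef_linear f) _. Qed.

Lemma coefZ f a v : coef f (a *: v) = a * coef f v.
Proof. exact: linZ (coef_linear f) _ _. Qed.

Lemma coef0 f : coef f 0 = 0.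
Proof. exact: lin0 (coef_linear f). Qed.

Lemma coef_sum f (J : finType) (F : J -> V) :
  coef f (\sum_j F j) = \sum_j coef f (F j).
Proof. exact: (big_morph _ (coefD f) (coef0 f)). Qed.

Lemma bilinear_ext_basisl (J J' : finType) (W : lmodType K) (tab : J -> J' -> W)
    j (v : {ffun J' -> K^o}) :
  bilinear_ext tab (ffun_basis K j) v = \sum_l (v l : K) *: tab j l.
Proof.
rewrite {1}[v]ffun_basis_sum (lin_sum (bilinear_ext_linearr _ _)).
apply: eq_bigr => l _.
by rewrite (linZ (bilinear_ext_linearr _ _)) bilinear_ext_basis.
Qed.

Lemma coef_act0 e v f : coef f (act0 (e0 e) v) = \sum_l sc (inl e) l f * coef l v.
Proof.
rewrite big_sumType /=; case: f => [f|f] /=.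
  rewrite [X in _ + X]big1 ?addr0 => [|b _]; last by rewrite mul0r.
  rewrite /SN_br00 bilinear_ext_basisl sum_ffunE; apply: eq_bigr => l _.
  by rewrite !ffunE mulrC.
rewrite [X in X + _]big1 ?add0r => [|b _]; last by rewrite mul0r.
rewrite /SN_br01 bilinear_ext_basisl sum_ffunE; apply: eq_bigr => l _.
by rewrite !ffunE mulrC.
Qed.

Lemma coef_act1 b v f : coef f (act1 (e1 b) v) = \sum_l sc (inr b) l f * coef l v.
Proof.
rewrite big_sumType /=; case: f => [f|f] /=.
  rewrite ffunE big1 => [|e _]; last by rewrite mul0r.
  by rewrite big1 ?addr0 // => b' _; rewrite mul0r.
rewrite [X in _ + X]big1 ?addr0 => [|b' _]; last by rewrite mul0r.
rewrite ffunE; move: (v.1) => u.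
rewrite {1}[u]ffun_basis_sum (lin_sum (SN_br01_linearl _)) sum_ffunE -sumrN.
apply: eq_bigr => e _.
rewrite (linZ (SN_br01_linearl _)) /SN_br01 bilinear_ext_basis.
by rewrite !ffunE mulNr mulrC.
Qed.

Definition on_basis (F0 : g0 -> V) (F1 : g1 -> V) (i : I) : V :=
  match i with inl e => F0 (e0 e) | inr b => F1 (e1 b) end.

Section OneCochain.

Variables (F0 : g0 -> V) (F1 : g1 -> V).
Hypotheses (F0_lin : linear F0) (F1_lin : linear F1).

Lemma coef_br00 e e' f : coef f (F0 (br00 (e0 e) (e0 e')))
  = \sum_l sc (inl e) (inl e') l * coef f (on_basis F0 F1 l).
Proof.
rewrite big_sumType /= [X in _ + X]big1 ?addr0 => [|b _]; last by rewrite mul0r.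
rewrite /SN_br00 bilinear_ext_basis {1}[table00 K e e']ffun_basis_sum.
rewrite (lin_sum F0_lin) coef_sum; apply: eq_bigr => l _.
by rewrite (linZ F0_lin) coefZ.
Qed.

Lemma coef_br01 e b f : coef f (F1 (br01 (e0 e) (e1 b)))
  = \sum_l sc (inl e) (inr b) l * coef f (on_basis F0 F1 l).
Proof.
rewrite big_sumType /= [X in X + _]big1 ?add0r => [|e' _]; last by rewrite mul0r.
rewrite /SN_br01 bilinear_ext_basis {1}[table01 K e b]ffun_basis_sum.
rewrite (lin_sum F1_lin) coef_sum; apply: eq_bigr => l _.
by rewrite (linZ F1_lin) coefZ.
Qed.

Definition d_on_basis (i j : I) : V :=
  match i, j with
  | inl e, inl e' => d00 (A := adjoint L) F0 (e0 e) (e0 e')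
  | inl e, inr b => d01 (A := adjoint L) F0 F1 (e0 e) (e1 b)
  | inr b, inr b' => d11 (A := adjoint L) F0 F1 (e1 b) (e1 b')
  | inr _, inl _ => 0
  end.

Local Arguments SN_sc : simpl never.

(** When both arguments are odd, the bracket term is zero on either side. *)
Lemma coef_d_on_basis i j f : ordered i j -> coef f (d_on_basis i j)
  = cobound1 (@odd_index k p n m) sc (fun l h => coef h (on_basis F0 F1 l)) i j f.
Proof.
case: i j => [e|b] [e'|b'] // _; rewrite /d_on_basis /d00 /d01 /d11 /cobound1 /=.
- rewrite expr0 mul1r 2!coefD coefN coef_br00.
  by congr (_ - _ + _); [apply: (coef_act0 e) | apply: (coef_act0 e')].
- rewrite expr0 mul1r 2!coefD coefN coef_br01.
  by rewrite (coef_act0 e) (coef_act1 b').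
- rewrite expr1 mulN1r 2!coefD !coefN (coef_act1 b) (coef_act1 b').
  rewrite (lin0 F0_lin) coef0.
  by rewrite [X in _ = X - _ + _]big1 // => l _; rewrite mul0r.
Qed.

End OneCochain.

Definition vec_of (I' : finType) (w : I' -> V) (u : {ffun I' -> K^o}) : V :=
  \sum_l (u l : K) *: w l.

Lemma vec_of_linear (I' : finType) (w : I' -> V) : linear (vec_of w).
Proof.
move=> a u v; rewrite /vec_of scaler_sumr -big_split; apply: eq_bigr => l _ /=.
by rewrite !ffunE scalerDl scalerA.
Qed.

Lemma vec_of_basis (I' : finType) (w : I' -> V) l : vec_of w (ffun_basis K l) = w l.
Proof.
rewrite /vec_of (bigD1 l) //= ffunE eqxx scale1r big1 ?addr0 // => l' /negbTE ne.
by rewrite ffunE ne scale0r.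
Qed.

Definition cochain1 (b : I -> I -> K)
    (gs : seq (even_part L)) (hs : seq (odd_part L)) : V :=
  match gs, hs with
  | [:: x], [::] => vec_of (fun e => of_coef (b (inl e))) x
  | [::], [:: h] => vec_of (fun e => of_coef (b (inr e))) h
  | _, _ => 0
  end.

Lemma cochain1P b : cochain 1 (cochain1 b).
Proof.
have lin00 (U : lmodType K) : linear (fun _ : U => 0 : V).
  by move=> a u v; rewrite scaler0 addr0.
split.
- by move=> [|x [|? ?]] [|h [|? ?]].
- move=> [|x [|? ?]] [|x' ?] [|h ?] //=;
    first [exact: vec_of_linear | exact: lin00].
- move=> [|x [|? ?]] [|h [|? ?]] [|h' ?] //=;
    first [exact: vec_of_linear | exact: lin00].
- by move=> [|x [|? ?]] [|x' ?].
- move=> gs hs hs' hh; have [le1|gt1] := leqP (size hs') 1.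
    by rewrite (perm_small_eq le1 hh).
  have c0 l : (1 < size l)%N -> cochain1 b gs l = 0.
    by case: l gs {hh} => [|? [|? ?]] // [|? [|? ?]].
  by rewrite !c0 // (perm_size hh).
Qed.

Lemma on_basis_cochain1 b l h :
  coef h (on_basis (fun x => cochain1 b [:: x] [::])
                   (fun x => cochain1 b [::] [:: x]) l)
  = b l h.
Proof. by case: l => l; rewrite /= vec_of_basis of_coefK. Qed.

Local Notation wt := (@wt K k p n m).
Local Notation cob1 := (cobound1 (@odd_index k p n m) sc).

Lemma br00_tor r (e : even_index p n) :
  br00 (e0 (inr r)) (e0 e) = wt r (inl e) *: e0 e.
Proof.
rewrite /= /SN_br00 bilinear_ext_basis; apply/ffunP => f.
transitivity (sc (tor n m r) (inl e) (inl f)); first by [].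
by rewrite sc_tor !ffunE eq_sym.
Qed.

Lemma br01_tor r (b : 'I_(psum m p)) :
  br01 (e0 (inr r)) (e1 b) = wt r (inr b) *: e1 b.
Proof.
rewrite /= /SN_br01 bilinear_ext_basis; apply/ffunP => f.
transitivity (sc (tor n m r) (inr b) (inr f)); first by [].
by rewrite sc_tor !ffunE eq_sym.
Qed.

Lemma coef_act0_tor r v f : coef f (act0 (e0 (inr r)) v) = wt r f * coef f v.
Proof. by rewrite (coef_act0 (inr r)) (sum_sc_tor_mid (coef^~ v)). Qed.

Implicit Type c : seq (even_part L) -> seq (odd_part L) -> V.

(** The value of a 2-cochain at two basis vectors; the pairs that start with an
    odd vector and end with an even one get the default value 0. *)
Definition at2 c (i j : I) : V :=
  match i with
  | inl e => on_basis (fun x => c [:: e0 e; x] [::]) (fun h => c [:: e0 e] [:: h]) j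
  | inr b => on_basis (fun=> 0) (fun h => c [::] [:: e1 b; h]) j
  end.

Definition differential_at c (i j : I) : V :=
  match i, j with
  | inl e, inl e' => differential c [:: e0 e; e0 e'] [::]
  | inl e, inr b => differential c [:: e0 e] [:: e1 b]
  | inr b, inr b' => differential c [::] [:: e1 b; e1 b']
  | inr _, inl _ => 0
  end.

Definition differential_at_tor c r (i j : I) : V :=
  match i, j with
  | inl e, inl e' => differential c [:: e0 (inr r); e0 e; e0 e'] [::]
  | inl e, inr b => differential c [:: e0 (inr r); e0 e] [:: e1 b]
  | inr b, inr b' => differential c [:: e0 (inr r)] [:: e1 b; e1 b']
  | inr _, inl _ => 0
  end.

Lemma differential_atE c i j : differential_at c i j
  = d_on_basis (fun x => c [:: x] [::]) (fun h => c [::] [:: h]) i j.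
Proof.
case: i j => [e|b] [e'|b'] //.
- exact: (@differential1_00 K L (adjoint L)).
- exact: (@differential1_01 K L (adjoint L)).
- exact: (@differential1_11 K L (adjoint L)).
Qed.

Lemma coef_differential_at c i j f : cochain 1 c -> ordered i j ->
  coef f (differential_at c i j) = cob1 (fun l h => coef h
    (on_basis (fun x => c [:: x] [::]) (fun h => c [::] [:: h]) l)) i j f.
Proof.
move=> cc oij; rewrite differential_atE coef_d_on_basis //.
  exact: (cochain_linear0 cc [::] [::] [::]).
exact: (cochain_linear1 cc [::] [::] [::]).
Qed.

Lemma coef_differential_at_tor c r i j f : cochain 2 c -> ordered i j ->
  coef f (differential_at_tor c r i j)
  = - (defect2 wt i j f r * coef f (at2 c i j))
    - cob1 (fun l h => coef h (at2 c (tor n m r) l)) i j f.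
Proof.
move=> cc oij; set t : even_part L := e0 (inr r).
have F0_lin : linear (fun x => c [:: t; x] [::]).
  exact: (cochain_linear0 cc [:: t] [::] [::]).
have F1_lin : linear (fun h => c [:: t] [:: h]).
  exact: (cochain_linear1 cc [:: t] [::] [::]).
rewrite -(coef_d_on_basis F0_lin F1_lin) // ffunE.
have coefE (a b : K) v w : wt r f * coef f v = coef f (act0 t v) ->
    coef f ((a + b) *: v - act0 t v - w)
    = - ((wt r f - a - b) * coef f v) - coef f w.
  by rewrite !(coefD, coefN) coefZ => <-; ring.
have act_t v : wt r f * coef f v = coef f (act0 t v) by rewrite coef_act0_tor.
case: i j oij => [e|b] [e'|b'] // _;
  rewrite /differential_at_tor /d_on_basis /at2 /on_basis.
- by rewrite (cartan00 cc (br00_tor r e) (br00_tor r e')) coefE.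
- by rewrite (cartan01 cc (br00_tor r e) (br01_tor r b')) coefE.
- by rewrite (cartan11 cc (br01_tor r b) (br01_tor r b')) coefE.
Qed.

Definition differential_at0 c (i : I) : V :=
  match i with
  | inl e => differential c [:: e0 e] [::]
  | inr b => differential c [::] [:: e1 b]
  end.

Lemma coef_differential_at0 c i f :
  coef f (differential_at0 c i) = cobound0 sc (fun l => coef l (c [::] [::])) i f.
Proof.
case: i => [e|b]; rewrite /differential_at0 /cobound0.
  by rewrite differential0_even coefN coef_act0.
by rewrite differential0_odd coefN coef_act1.
Qed.

Definition cochain0 (v : V) (gs : seq (even_part L)) (hs : seq (odd_part L)) : V :=
  match gs, hs with [::], [::] => v | _, _ => 0 end.

Lemma cochain0P v : cochain 0 (cochain0 v).
Proof.
have lin00 (U : lmodType K) : linear (fun _ : U => 0 : V).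
  by move=> a u w; rewrite scaler0 addr0.
split.
- by move=> [|? ?] [|? ?].
- by move=> [|? ?] gs' hs; apply: lin00.
- by move=> [|? ?] [|? ?] hs'; apply: lin00.
- by move=> [|? ?].
- by move=> [|? ?] [|? ?] [|? ?] // /perm_size.
Qed.

Lemma eq_linear (U W : lmodType K) (F G : U -> W) : F =1 G -> linear G -> linear F.
Proof. by move=> FG G_lin a u v; rewrite !FG G_lin. Qed.

Lemma bilinear_eq_basis (J J' : finType) (W : lmodType K)
    (F G : {ffun J -> K^o} -> {ffun J' -> K^o} -> W) :
    (forall y, linear (F^~ y)) -> (forall x, linear (F x)) ->
    (forall y, linear (G^~ y)) -> (forall x, linear (G x)) ->
    (forall i j, F (ffun_basis K i) (ffun_basis K j)
               = G (ffun_basis K i) (ffun_basis K j)) ->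
  F =2 G.
Proof.
move=> Fl Fr Gl Gr FG x y; move: x.
apply: (linear_eq_basis (Fl y) (Gl y)) => i.
by move: y; apply: (linear_eq_basis (Fr _) (Gr _)) => j; apply: FG.
Qed.

Hypotheses (charK0 : [pchar K] =i pred0).
Hypotheses (hn : forall j, (1 <= n j)%N) (hm : forall j, (1 <= m j)%N).

(** * Cohomology of SN *)

Lemma SN_vanishing0 : cohomology_vanishes (adjoint L) 0.
Proof.
move=> c [cc dc] gs hs.
suff c0 : c [::] [::] = 0.
  have [sz0|] := eqVneq (size gs + size hs)%N 0%N; last exact: cochain_support.
  by move: gs hs sz0 => [|? ?] [|? ?].
apply: coef_inj => f; rewrite coef0.
apply: (coef_vanishing0 charK0 hn hm (v := fun l => coef l (c [::] [::]))) => i f'.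
rewrite -coef_differential_at0.
by case: i => [e|b]; rewrite /differential_at0 dc coef0.
Qed.

Lemma SN_vanishing1 : cohomology_vanishes (adjoint L) 1.
Proof.
move=> c [cc dc].
pose D l h := coef h (on_basis (fun x => c [:: x] [::]) (fun x => c [::] [:: x]) l).
have [|v vE] := coef_vanishing1 charK0 hn hm (D := D).
  move=> i j f ei; rewrite -coef_differential_at ?/ordered ?(negbTE ei) //.
  by case: i j ei => [e|b] [e'|b'] // _; rewrite /differential_at ?dc coef0.
have on_basisE i f : D i f = coef f (differential_at0 (cochain0 (of_coef v)) i).
  rewrite vE coef_differential_at0 /cobound0; congr (- _).
  by apply: eq_bigr => l _; rewrite of_coefK.
exists (cochain0 (of_coef v)); first exact: cochain0P.
move=> gs hs; have [sz1|ne] := eqVneq (size gs + size hs)%N 1%N; last first.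
  by rewrite (cochain_support cc) // (differential_support (cochain0P _)).
case: gs hs sz1 => [|x [|? ?]] [|h [|? ?]] //= _.
- move: h; apply: linear_eq_basis; first exact: (cochain_linear1 cc [::] [::] [::]).
    apply: (eq_linear (G := fun h => - act1 h (of_coef v))).
      by move=> h; rewrite differential0_odd.
    by move=> a u w; rewrite (act1_linearl (of_coef v)) opprD scalerN.
  by move=> b; apply: coef_inj => f; apply: (on_basisE (inr b)).
- move: x; apply: linear_eq_basis; first exact: (cochain_linear0 cc [::] [::] [::]).
    apply: (eq_linear (G := fun x => - act0 x (of_coef v))).
      by move=> x; rewrite differential0_even.
    by move=> a u w; rewrite (act0_linearl (of_coef v)) opprD scalerN.
  by move=> e; apply: coef_inj => f; apply: (on_basisE (inl e)).
Qed.

Lemma SN_vanishing2 : cohomology_vanishes (adjoint L) 2.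
Proof.
move=> c [cc dc].
have [||b bE] := coef_vanishing2 charK0 hn hm (C := fun i j f => coef f (at2 c i j)).
- case=> [e|//] [e'|//] f _ _; rewrite /at2 /on_basis.
  by rewrite (cochain2_swap _ _ _ cc) coefN.
- move=> r i j f oij; apply/eqP; rewrite -[_ * _]opprK eqr_opp -subr_eq0.
  rewrite -coef_differential_at_tor //; apply/eqP.
  by case: i j oij => [e|b] [e'|b'] // _; rewrite /differential_at_tor dc coef0.
have B_lin0 := cochain_linear0 (cochain1P b) [::] [::] [::].
have B_lin1 := cochain_linear1 (cochain1P b) [::] [::] [::].
have on_basisE i j : ordered i j -> at2 c i j = differential_at (cochain1 b) i j.
  move=> oij; apply: coef_inj => f; rewrite bE // coef_differential_at //; last first.
    exact: cochain1P.
  by rewrite /cobound1; congr (_ - _ + _ * _); apply: eq_bigr => l _;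
    rewrite on_basis_cochain1.
exists (cochain1 b); first exact: cochain1P.
move=> gs hs; have [sz2|ne] := eqVneq (size gs + size hs)%N 2%N; last first.
  by rewrite (cochain_support cc) // (differential_support (cochain1P _)).
case: gs hs sz2 => [|x [|y [|? ?]]] [|h [|h' [|? ?]]] //= _.
- rewrite differential1_11; move: h h'; apply: bilinear_eq_basis.
  + by move=> h'; apply: (cochain_linear1 cc [::] [::] [:: h']).
  + by move=> h; apply: (cochain_linear1 cc [::] [:: h] [::]).
  + by move=> h'; apply: (d11_linearl B_lin0 B_lin1 h').
  + by move=> h; apply: (d11_linearr B_lin0 B_lin1 h).
  + move=> i j; rewrite -differential1_11.
    exact: (on_basisE (inr i) (inr j)).
- rewrite differential1_01; move: x h; apply: bilinear_eq_basis.
  + by move=> h; apply: (cochain_linear0 cc [::] [::] [:: h]).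
  + by move=> x; apply: (cochain_linear1 cc [:: x] [::] [::]).
  + by move=> h; apply: (d01_linearl B_lin0 B_lin1 h).
  + by move=> x; apply: (d01_linearr _ B_lin1 x).
  + move=> i j; rewrite -differential1_01.
    exact: (on_basisE (inl i) (inr j)).
- rewrite differential1_00; move: x y; apply: bilinear_eq_basis.
  + by move=> y; apply: (cochain_linear0 cc [::] [:: y] [::]).
  + by move=> x; apply: (cochain_linear0 cc [:: x] [::] [::]).
  + by move=> y; apply: (d00_linearl B_lin0 y).
  + by move=> x; apply: (d00_linearr B_lin0 x).
  + move=> i j; rewrite -differential1_00.
    exact: (on_basisE (inl i) (inl j)).
Qed.

End Coordinates.

Theorem theorem5p1 (K : fieldType) (charK0 : [pchar K]%R =i pred0)
    (k p : nat) (hk : (1 <= k)%N) (hp : (1 <= p)%N)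
    (n : 'I_k -> nat) (m : 'I_p -> nat)
    (hn : forall j, (1 <= n j)%N) (hm : forall j, (1 <= m j)%N) :
  complete (SN K n m).
Proof.
move=> [|[|[|//]]] _.
- exact: SN_vanishing0.
- exact: SN_vanishing1.
- exact: SN_vanishing2.
Qed.
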